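(* Let $R$ be a non-degenerate matrix-valued noncommutative rational expression in $d=d_1+d_2$ formal variables. For each $N\in\mathbb{N}$, let $\mu^N_{d_1,d_2}$ be a probability measure on $M_N(\mathbb{C})_{\mathrm{sa}}^{d_1}\times U_N(\mathbb{C})^{d_2}$ which is absolutely continuous with respect to the product measure of the Lebesgue measure on $M_N(\mathbb{C})_{\mathrm{sa}}$ and the Haar measure on $U_N(\mathbb{C})$, and let $(X^N,U^N)$ be a tuple of random matrices in $M_N(\mathbb{C})_{\mathrm{sa}}^{d_1}\times U_N(\mathbb{C})^{d_2}$ with law $\mu^N_{d_1,d_2}$. Then there exists $N_0\in\mathbb{N}$ such that almost surely $(X^N,U^N)\in\mathrm{dom}_{M_N(\mathbb{C})}(R)$ for all $N\ge N_0$.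
   Context: $M_N(\mathbb{C})_{\mathrm{sa}}$ is the real vector space of self-adjoint complex $N\times N$ matrices and $U_N(\mathbb{C})$ is the unitary group. **Matrix-valued noncommutative rational expressions.** In formal variables $x_1,\dots,x_d$, these are formal (syntactic) expressions, not subject to any arithmetic identities, built recursively together with, for each unital complex algebra $\mathcal{A}$, a domain $\mathrm{dom}_{\mathcal{A}}(R)\subseteq\mathcal{A}^d$ and an evaluation $R(X)\in M_{p\times q}(\mathbb{C})\otimes\mathcal{A}\cong M_{p\times q}(\mathcal{A})$ for $X\in\mathrm{dom}_{\mathcal{A}}(R)$ when $R$ is of size $p\times q$: - For $A\in M_{p\times q}(\mathbb{C})$, the symbols $R=A\otimes 1$ and $R=A\otimes x_j$ are $p\times q$ expressions with domain $\mathcal{A}^d$ and $R(X)=A\otimes 1_{\mathcal{A}}$, resp. $R(X)=A\otimes X_j$. - If $R_1,R_2$ are $p\times q$ expressions, so is $R_1+R_2$, with domain $\mathrm{dom}_{\mathcal{A}}(R_1)\cap\mathrm{dom}_{\mathcal{A}}(R_2)$ and $(R_1+R_2)(X)=R_1(X)+R_2(X)$. - If $R_1,R_2$ are $p\times q$ and $q\times r$ expressions, $R_1\cdot R_2$ is a $p\times r$ expression with domain $\mathrm{dom}_{\mathcal{A}}(R_1)\cap\mathrm{dom}_{\mathcal{A}}(R_2)$ and $(R_1\cdot R_2)(X)=R_1(X)R_2(X)$. - If $R$ is a $p\times p$ expression, so is $R^{-1}$, with $\mathrm{dom}_{\mathcal{A}}(R^{-1})=\{X\in\mathrm{dom}_{\mathcal{A}}(R):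 R(X)\text{ invertible in }M_p(\mathcal{A})\}$ and $R^{-1}(X)=R(X)^{-1}$. $R$ is *non-degenerate* if $\mathrm{dom}_{M_N(\mathbb{C})}(R)\neq\emptyset$ for some $N\ge1$. *)

(* Defs.v *)
From HB Require Import structures.
From mathcomp Require Import all_boot all_order all_algebra.
From mathcomp Require Import sesquilinear spectral.
From mathcomp Require Import all_classical all_reals all_analysis.
From mathcomp.real_closed Require Import complex.

Set Implicit Arguments.
Unset Strict Implicit.
Unset Printing Implicit Defensive.

Import Order.TTheory GRing.Theory Num.Theory.

Local Open Scope classical_set_scope.
Local Open Scope ring_scope.

Inductive ncrat (C : Type) (d : nat) : nat -> nat -> Type :=
| NCcst p q of 'M[C]_(p, q) : ncrat C d p q
| NCvar p q of 'M[C]_(p, q) & 'I_d : ncrat C d p q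
| NCadd p q of ncrat C d p q & ncrat C d p q : ncrat C d p q
| NCmul p q r of ncrat C d p q & ncrat C d q r : ncrat C d p r
| NCinv p of ncrat C d p p : ncrat C d p p.

Section evaluation.
Context (C : fieldType) (d : nat) (A : algType C).

(* The entries lie in a possibly noncommutative algebra, for which invmx is
   not available. *)
Definition is_inverse_mx n (M B : 'M[A]_n) := M *m B = 1%:M /\ B *m M = 1%:M.

(* The junk value 0 at non-invertible matrices is never used on ncdom. *)
Definition inverse_mx n (M : 'M[A]_n) : 'M[A]_n :=
  xget 0 [set B | is_inverse_mx M B].

Variable X : 'I_d -> A.

Fixpoint nceval p q (e : ncrat C d p q) : 'M[A]_(p, q) :=
  match e with
  | NCcst _ _ M => map_mx (fun a : C => a%:A) M
  | NCvar _ _ M j => map_mx (fun a : C => a *: X j) M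
  | NCadd _ _ e1 e2 => nceval e1 + nceval e2
  | NCmul _ _ _ e1 e2 => nceval e1 *m nceval e2
  | NCinv _ e1 => inverse_mx (nceval e1)
  end.

Fixpoint ncdom p q (e : ncrat C d p q) : Prop :=
  match e with
  | NCcst _ _ _ => True
  | NCvar _ _ _ _ => True
  | NCadd _ _ e1 e2 => ncdom e1 /\ ncdom e2
  | NCmul _ _ _ e1 e2 => ncdom e1 /\ ncdom e2
  | NCinv _ e1 => ncdom e1 /\ exists B, is_inverse_mx (nceval e1) B
  end.

End evaluation.

(* Sizes N >= 1 are written N.+1, so that 'M_N.+1 is an algType. *)
Definition nc_nondegenerate (C : fieldType) d p q (e : ncrat C d p q) :=
  exists (N : nat) (X : 'I_d -> 'M[C]_N.+1), ncdom X e.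

Section push.
Local Open Scope ereal_scope.
Context d1 d2 (T1 : measurableType d1) (T2 : measurableType d2) (R : realType).
Context (m : {sigma_finite_measure set T1 -> \bar R}).
Context (f : T1 -> T2) (g : T2 -> T1).
Context (mf : measurable_fun setT f) (mg : measurable_fun setT g).
Context (fK : cancel f g).

(* The measurable left inverse g is what makes the image measure
   sigma-finite. *)
Definition push of measurable_fun setT f & measurable_fun setT g & cancel f g :=
  pushforward m f.

Local Notation pm := (push mf mg fK).

Let pm0 : pm set0 = 0. Proof. by rewrite /push /pushforward preimage_set0. Qed.

Let pm_ge0 A : 0 <= pm A. Proof. exact: measure_ge0. Qed.

Let pm_sigma_additive : semi_sigma_additive pm.
Proof.
move=> F mF tF mUF; rewrite /push /pushforward preimage_bigcup.
apply: measure_semi_sigma_additive.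
- by move=> n; rewrite -[X in measurable X]setTI; exact: mf.
- apply/trivIsetP => /= i j _ _ ij; rewrite -preimage_setI.
  by move/trivIsetP : tF => /(_ _ _ _ _ ij) ->//; rewrite preimage_set0.
- by rewrite -preimage_bigcup -[X in measurable X]setTI; exact: mf.
Qed.

HB.instance Definition _ := isMeasure.Build _ _ _ pm
  pm0 pm_ge0 pm_sigma_additive.

Let pm_sigma_finite : sigma_finite setT pm.
Proof.
have [F FT Foo] := sigma_finiteT m.
exists (fun n => g @^-1` F n); first by rewrite -preimage_bigcup -FT.
move=> n; have [mF Fn] := Foo n; split.
  by rewrite -[X in measurable X]setTI; exact: mg.
rewrite /push /pushforward (_ : f @^-1` _ = F n)//.
by apply/seteqP; split => x /=; rewrite fK.
Qed.

HB.instance Definition _ := Measure_isSigmaFinite.Build _ _ _ pm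
  pm_sigma_finite.

End push.

Section sigma_finite_product.
Local Open Scope ereal_scope.
Context d1 d2 (T1 : measurableType d1) (T2 : measurableType d2) (R : realType).
Context (m1 : {sigma_finite_measure set T1 -> \bar R}).
Context (m2 : {sigma_finite_measure set T2 -> \bar R}).

(* Alias of \x: the instances inferred for \x itself require the factors to be
   subprobabilities before they give sigma-finiteness. *)
Definition sfprod := m1 \x m2.

HB.instance Definition _ := Measure.copy sfprod (m1 \x m2).

Let sfprod_sigma_finite : sigma_finite setT sfprod.
Proof.
have /sigma_finiteP[F [TF ndF Foo]] := sigma_finiteT m1.
have /sigma_finiteP[G [TG ndG Goo]] := sigma_finiteT m2.
exists (fun n => F n `*` G n).
  rewrite -setXTT TF TG predeqE => -[x y]; split.
    move=> [/= [n _ Fnx] [k _ Gky]]; exists (maxn n k) => //; split.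
    - by move: x Fnx; exact/subsetPset/ndF/leq_maxl.
    - by move: y Gky; exact/subsetPset/ndG/leq_maxr.
  by move=> [n _ []/= ? ?]; split; exists n.
move=> k; have [? ?] := Foo k; have [? ?] := Goo k.
split; first exact: measurableX.
by rewrite /sfprod product_measure1E// lte_mul_pinfty// ge0_fin_numE.
Qed.

HB.instance Definition _ := Measure_isSigmaFinite.Build _ _ _ sfprod
  sfprod_sigma_finite.

End sigma_finite_product.

Section power_measure.
Context d (T : measurableType d) (R : realType).

Definition tcons n (x : T * n.-tuple T) : n.+1.-tuple T := [tuple of x.1 :: x.2].

Definition tuncons n (t : n.+1.-tuple T) : T * n.-tuple T :=
  (thead t, [tuple of behead t]).

Lemma measurable_tcons n : measurable_fun setT (@tcons n).
Proof. exact: measurable_cons. Qed.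

Lemma measurable_tuncons n : measurable_fun setT (@tuncons n).
Proof.
apply/measurable_fun_pairP; split; first exact: measurable_tnth.
exact: measurable_behead.
Qed.

Lemma tconsK n : cancel (@tcons n) (@tuncons n).
Proof. by case=> x t; congr (_, _); apply/val_inj. Qed.

Fixpoint power_measure (mu : {sigma_finite_measure set T -> \bar R}) (n : nat) :
    {sigma_finite_measure set (n.-tuple T) -> \bar R} :=
  match n with
  | 0 => dirac [tuple]
  | n'.+1 => push (sfprod mu (power_measure mu n'))
      (@measurable_tcons n') (@measurable_tuncons n') (@tconsK n')
  end.

End power_measure.

Section matrix_spaces.
Local Open Scope complex_scope.
Context (R : realType) (n : nat).
Local Notation C := R[i].

Record selfadj := Selfadj {
  selfadj_mx :> 'M[C]_n;
  selfadj_mxP : selfadj_mx \is hermsymmx }.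

HB.instance Definition _ := [isSub for selfadj_mx].
HB.instance Definition _ := [Choice of selfadj by <:].

Record unitary := Unitary {
  unitary_mx :> 'M[C]_n;
  unitary_mxP : unitary_mx \is unitarymx }.

HB.instance Definition _ := [isSub for unitary_mx].
HB.instance Definition _ := [Choice of unitary by <:].

Lemma selfadjE (A : selfadj) i j : A j i = (A i j)^*%C.
Proof. by move/is_hermitianmxP: (selfadj_mxP A) => {1}->; rewrite scale1r !mxE. Qed.

Lemma selfadj0_subproof : (0 : 'M[C]_n) \is hermsymmx.
Proof. by apply/is_hermitianmxP; rewrite scale1r trmx0 map_mx0. Qed.

HB.instance Definition _ := isPointed.Build selfadj (Selfadj selfadj0_subproof).

Lemma unitary1_subproof : (1%:M : 'M[C]_n) \is unitarymx.
Proof. by apply/unitarymxP; rewrite mul1mx trmx1 map_mx1. Qed.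

HB.instance Definition _ := isPointed.Build unitary (Unitary unitary1_subproof).

Definition unitary_mul (U V : unitary) : unitary :=
  Unitary (mul_unitarymx (unitary_mxP U) (unitary_mxP V)).

(* The coordinates of M_n(C) as a real vector space of dimension 2n^2; the
   Borel sigma-algebra of a subset of M_n(C) is the one they generate. *)
Definition real_coord (A : 'M[C]_n) : (n * n).-tuple (R * R) :=
  [tuple (complex.Re (mxvec A 0 k), complex.Im (mxvec A 0 k)) | k < n * n].

Definition selfadj_coord (A : selfadj) := real_coord A.
Definition unitary_coord (U : unitary) := real_coord U.

HB.instance Definition _ := Measurable.copy selfadj
  (g_sigma_algebra_preimageType selfadj_coord).
HB.instance Definition _ := Measurable.copy unitary
  (g_sigma_algebra_preimageType unitary_coord).

Lemma measurable_selfadj_entry (i j : 'I_n) :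
  measurable_fun setT (fun A : selfadj => complex.Re (selfadj_mx A i j)) /\
  measurable_fun setT (fun A : selfadj => complex.Im (selfadj_mx A i j)).
Proof.
pose t (A : selfadj) := tnth (selfadj_coord A) (mxvec_index i j).
have mt : measurable_fun setT t.
  apply: (measurableT_comp (measurable_tnth (mxvec_index i j))).
  by move=> _ Y mY; exists Y.
split.
- rewrite (_ : (fun _ => _) = fst \o t); first exact: measurableT_comp.
  by apply/funext => A; rewrite /t /= tnth_mktuple mxvecE.
- rewrite (_ : (fun _ => _) = snd \o t); first exact: measurableT_comp.
  by apply/funext => A; rewrite /t /= tnth_mktuple mxvecE.
Qed.

Definition selfadj_entry (t : (n * n).-tuple R) (i j : 'I_n) : C :=
  let b i j := tnth t (mxvec_index i j) in
  if i == j then (b i i)%:C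
  else if (i < j)%N then b i j +i* b j i
  else b j i -i* b i j.

Lemma selfadj_entry_subproof t :
  \matrix_(i, j) selfadj_entry t i j \is hermsymmx.
Proof.
apply/is_hermitianmxP; rewrite scale1r; apply/matrixP => i j.
rewrite !mxE /selfadj_entry; have [->|ji] := eqVneq i j.
  by apply/eqP; rewrite eq_complex/= oppr0 !eqxx.
rewrite ?(eq_sym j) ?(negbTE ji).
case: (ltngtP i j) => [ij|ij|/val_inj ij]; last by rewrite ij eqxx in ji.
- by apply/eqP; rewrite eq_complex/= opprK !eqxx.
- by [].
Qed.

(* The diagonal and the upper triangle of a self-adjoint matrix: this
   identifies M_n(C)_sa with R^(n^2) as real vector spaces. *)
Definition selfadj_of_real (t : (n * n).-tuple R) : selfadj :=
  Selfadj (selfadj_entry_subproof t).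

Definition real_of_selfadj (A : selfadj) : (n * n).-tuple R :=
  [tuple mxvec (\matrix_(i, j) if (i <= j)%N then complex.Re (selfadj_mx A i j)
                               else complex.Im (selfadj_mx A j i)) 0 k
  | k < n * n].

Lemma selfadj_of_realK : cancel selfadj_of_real real_of_selfadj.
Proof.
move=> t; apply: eq_from_tnth => k; rewrite tnth_mktuple.
case/mxvec_indexP: k => i j; rewrite mxvecE !mxE /selfadj_entry.
case: (ltngtP i j) => [ij|ij|/val_inj ->].
- by rewrite /= lt_eqF.
- by rewrite /= lt_eqF.
- by rewrite eqxx.
Qed.

Lemma real_of_selfadjK : cancel real_of_selfadj selfadj_of_real.
Proof.
move=> A; apply/val_inj/matrixP => i j; rewrite !mxE /selfadj_entry.
rewrite !tnth_mktuple !mxvecE !mxE leqnn.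
case: eqVneq => [->|ij].
  have := selfadjE A j j; case: (selfadj_mx A j j) => a b [/eqP].
  by rewrite -addr_eq0 -mulr2n mulrn_eq0/= => /eqP->.
have [ji|ji|/val_inj ji] := ltngtP i j; last by rewrite ji eqxx in ij.
- by case: (selfadj_mx A i j).
- by rewrite (selfadjE A j i); case: (selfadj_mx A j i).
Qed.

Lemma measurable_real_of_selfadj : measurable_fun setT real_of_selfadj.
Proof.
apply/measurable_fun_tnthP => k; case/mxvec_indexP: k => i j.
pose f (A : selfadj) := if (i <= j)%N then complex.Re (selfadj_mx A i j)
                        else complex.Im (selfadj_mx A j i).
suff : measurable_fun setT f.
  apply: eq_measurable_fun => A _.
  by rewrite /= tnth_mktuple mxvecE mxE.
rewrite /f; case: (i <= j)%N.
- exact: (measurable_selfadj_entry i j).1.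
- exact: (measurable_selfadj_entry j i).2.
Qed.

Lemma measurable_selfadj_of_real : measurable_fun setT selfadj_of_real.
Proof.
suff m : measurable_fun setT (selfadj_coord \o selfadj_of_real).
  by move=> _ _ [Y mY <-]; rewrite setTI; exact: m.
apply/measurable_fun_tnthP => k; case/mxvec_indexP: k => i j.
pose f t := (complex.Re (selfadj_entry t i j), complex.Im (selfadj_entry t i j)).
suff : measurable_fun setT f.
  apply: eq_measurable_fun => t _.
  by rewrite /= tnth_mktuple mxvecE mxE.
have mt i' j' := @measurable_tnth _ R (n * n) (mxvec_index i' j').
rewrite /f /selfadj_entry; case: (i == j); last case: (i < j)%N;
  apply: measurable_fun_pair => //=; exact: measurableT_comp.
Qed.

Definition lebesgue_selfadj : {sigma_finite_measure set selfadj -> \bar R} :=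
  push (power_measure (@lebesgue_measure R) (n * n))
    measurable_selfadj_of_real measurable_real_of_selfadj selfadj_of_realK.

(* On a compact group the Haar measure is the unique left-invariant
   Borel probability measure. *)
Definition is_haar (h : probability unitary R) :=
  forall (U : unitary) (B : set unitary), measurable B ->
    h (unitary_mul U @^-1` B) = h B.

End matrix_spaces.

Notation matspace R d1 d2 n :=
  (d1.-tuple (selfadj R n) * d2.-tuple (unitary R n))%type.

Section tuples_of_matrices.
Context (R : realType) (d1 d2 n : nat).

Definition reference_measure (haar : probability (unitary R n) R) :
    {sigma_finite_measure set (matspace R d1 d2 n) -> \bar R} :=
  sfprod (power_measure (lebesgue_selfadj R n) d1) (power_measure haar d2).

Definition matrices_of (XU : matspace R d1 d2 n) (j : 'I_(d1 + d2)) :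
    'M[R[i]]_n :=
  match fintype.split j with
  | inl k => selfadj_mx (tnth XU.1 k)
  | inr k => unitary_mx (tnth XU.2 k)
  end.

End tuples_of_matrices.
Arguments reference_measure {R} d1 d2 {n} haar.

(* Main.v *)
Require Import Defs.
From HB Require Import structures.
From mathcomp Require Import all_boot all_order all_algebra.
From mathcomp Require Import all_classical all_reals all_analysis.
From mathcomp Require Import cyclic separable cyclotomic spectral.
From mathcomp Require Import measurable_realfun zify ring.
From mathcomp Require finmap.
From mathcomp.real_closed Require Import complex mxtens.

(** At each size [n] an expression has a common denominator that is a polynomial
    in the entries of the matrices, so the domain is the complement of its zero
    set.  It remains to see that this polynomial is nonzero for all large [n],
    and that a nonzero one vanishes only on a null set.

    The first point is an induction on the expression.  For [e^-1], with [e] of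
    size [p] invertible at a tuple [X0] of size [m], write [n = k m + s] with
    [s] bounded and in the range where [e] is defined: on a direct sum of [k]
    copies of [X0] and a tuple of size [s], [e] has rank at least [k p m].  This
    tuple is a specialization of matrices [X] over C[x][t] that satisfy
    [v X = sigma(X) v], where [v^n = t] and [sigma] multiplies [x] by a
    primitive [n]-th root of unity.  These matrices form an order in a cyclic
    division algebra of degree [n], so if [e(X)] is singular then its kernel has
    dimension at least [n], and its rank is at most [p n - n]; this contradicts
    the lower bound [k p m] when [n > p s].

    For the second point, Fubini's theorem reduces the Lebesgue measure to
    polynomials in one real variable.  A Haar measure is transported to the
    Lebesgue measure on self-adjoint matrices [A]: by left invariance and
    Fubini, it suffices that for each unitary [U] almost every [A] has
    [(A + i)^-1 (A - i) U] in the domain. *)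

Set Implicit Arguments.
Unset Strict Implicit.
Unset Printing Implicit Defensive.

Import Order.TTheory GRing.Theory Num.Theory.
Local Open Scope classical_set_scope.
Local Open Scope ring_scope.

(** * Evaluation over commutative coefficients *)

Section fraction_evaluation.
Context {C : Type} {d : nat}.

Section definitions.
Context (P : comNzRingType) (iota : C -> P) (n : nat).
Context (Y : 'I_d -> 'M[P]_n) (h : 'I_d -> P).

(* A common denominator (entry 1) and the numerator (entry 2) of the value of
   [e] at the tuple [Y j / h j], as polynomials in the entries of [Y] and [h];
   [p x q] matrices over [M_n(P)] are flattened by the Kronecker product. *)
Fixpoint ncfrac p q (e : ncrat C d p q) : P * 'M[P]_(p * n, q * n) :=
  match e with
  | NCcst _ _ M => (1, map_mx iota M *t 1%:M)
  | NCvar _ _ M j => (h j, map_mx iota M *t Y j)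
  | NCadd _ _ e1 e2 =>
      let x := ncfrac e1 in let y := ncfrac e2 in
      (x.1 * y.1, y.1 *: x.2 + x.1 *: y.2)
  | NCmul _ _ _ e1 e2 =>
      let x := ncfrac e1 in let y := ncfrac e2 in
      (x.1 * y.1, x.2 *m y.2)
  | NCinv _ e1 =>
      let x := ncfrac e1 in (x.1 * \det x.2, x.1 ^+ 2 *: \adj x.2)
  end.

End definitions.

Section field_definitions.
Context (K : fieldType) (iota : C -> K) (n : nat) (X : 'I_d -> 'M[K]_n).

(** Values are flattened to matrices over [K]. At a singular matrix [invmx] returns its argument, a
    default value that [mxdom] excludes. *)
Fixpoint mxeval p q (e : ncrat C d p q) : 'M[K]_(p * n, q * n) :=
  match e with
  | NCcst _ _ M => map_mx iota M *t 1%:M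
  | NCvar _ _ M j => map_mx iota M *t X j
  | NCadd _ _ e1 e2 => mxeval e1 + mxeval e2
  | NCmul _ _ _ e1 e2 => mxeval e1 *m mxeval e2
  | NCinv _ e1 => invmx (mxeval e1)
  end.

Fixpoint mxdom p q (e : ncrat C d p q) : bool :=
  match e with
  | NCcst _ _ _ | NCvar _ _ _ _ => true
  | NCadd _ _ e1 e2 => mxdom e1 && mxdom e2
  | NCmul _ _ _ e1 e2 => mxdom e1 && mxdom e2
  | NCinv _ e1 => mxdom e1 && (mxeval e1 \in unitmx)
  end.

End field_definitions.

(** Only ring operations, determinants and adjugates enter [ncfrac], and these commute with ring
    morphisms. Hence numerators and denominators can be specialized even where a denominator
    vanishes. *)
Lemma ncfrac_map (P P' : comNzRingType) (f : {rmorphism P -> P'})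
    (iota : C -> P) n (Y : 'I_d -> 'M[P]_n) (h : 'I_d -> P)
    p q (e : ncrat C d p q) :
  ncfrac (f \o iota) (fun j => map_mx f (Y j)) (f \o h) e =
  (f (ncfrac iota Y h e).1, map_mx f (ncfrac iota Y h e).2).
Proof.
elim: e => //=.
- by move=> p' q' M; rewrite rmorph1 map_mxT map_mx1 -map_mx_comp.
- by move=> p' q' M j; rewrite map_mxT -map_mx_comp.
- by move=> p' q' e1 -> e2 -> /=; rewrite rmorphM map_mxD !map_mxZ.
- by move=> p' q' r e1 -> e2 -> /=; rewrite rmorphM map_mxM.
- by move=> p' e1 -> /=; rewrite rmorphM map_mxZ rmorphXn map_mx_adj det_map_mx.
Qed.

Lemma ncfrac_map1 (P P' : comNzRingType) (f : {rmorphism P -> P'})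
    (iota : C -> P) (iota' : C -> P') (f_iota : forall c, f (iota c) = iota' c)
    n (Y : 'I_d -> 'M[P]_n) p q (e : ncrat C d p q) :
  ncfrac iota' (fun j => map_mx f (Y j)) (fun=> 1) e =
  (f (ncfrac iota Y (fun=> 1) e).1, map_mx f (ncfrac iota Y (fun=> 1) e).2).
Proof.
rewrite -ncfrac_map.
have <- : f \o iota = iota' by apply/funext.
by have -> : f \o (fun=> 1) = (fun=> 1) :> ('I_d -> P')
  by apply/funext => j /=; rewrite rmorph1.
Qed.

End fraction_evaluation.

(** * Function classes closed under polynomial operations *)

Section closed_function_classes.
Context (P : comNzRingType) (T : Type).

(** The instances are the polynomial functions of a parameter and the measurable functions, so
    [ncfrac_closed] yields both polynomiality and measurability of denominators. *)
Definition function_algebra (S : (T -> P) -> Prop) : Prop :=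
  [/\ forall a, S (fun=> a),
      forall f g, S f -> S g -> S (fun t => f t + g t) &
      forall f g, S f -> S g -> S (fun t => f t * g t)].

Context (S : (T -> P) -> Prop) (S_alg : function_algebra S).

Let S_cst a : S (fun=> a).
Proof. by case: S_alg => + _ _; apply. Qed.

Let S_add f g : S f -> S g -> S (fun t => f t + g t).
Proof. by case: S_alg => _ + _; apply. Qed.

Let S_mul f g : S f -> S g -> S (fun t => f t * g t).
Proof. by case: S_alg => _ _; apply. Qed.

Let S_ext f g : f =1 g -> S g -> S f.
Proof. by move=> /funext ->. Qed.

Lemma closed_sum (I : Type) (r : seq I) (F : I -> T -> P) :
  (forall i, S (F i)) -> S (fun t => \sum_(i <- r) F i t).
Proof.
move=> SF; elim: r => [|i r IH].
  by apply: (S_ext (g := fun=> 0)) => // t; rewrite big_nil.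
apply: S_ext (S_add (SF i) IH) => t; exact: big_cons.
Qed.

Lemma closed_prod (I : Type) (r : seq I) (F : I -> T -> P) :
  (forall i, S (F i)) -> S (fun t => \prod_(i <- r) F i t).
Proof.
move=> SF; elim: r => [|i r IH].
  by apply: (S_ext (g := fun=> 1)) => // t; rewrite big_nil.
apply: S_ext (S_mul (SF i) IH) => t; exact: big_cons.
Qed.

Lemma closed_mulmx m n p (A : T -> 'M[P]_(m, n)) (B : T -> 'M[P]_(n, p)) a b :
  (forall a b, S (fun t => A t a b)) -> (forall a b, S (fun t => B t a b)) ->
  S (fun t => (A t *m B t) a b).
Proof.
move=> SA SB.
have := closed_sum (index_enum _) (fun k => S_mul (SA a k) (SB k b)).
by apply: S_ext => t; rewrite !mxE.
Qed.

Lemma closed_det m (A : T -> 'M[P]_m) :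
  (forall a b, S (fun t => A t a b)) -> S (fun t => \det (A t)).
Proof.
move=> SA; apply: closed_sum => s.
by apply: S_mul => //; apply: closed_prod.
Qed.

Lemma closed_adj m (A : T -> 'M[P]_m) a b :
  (forall a b, S (fun t => A t a b)) -> S (fun t => (\adj (A t)) a b).
Proof.
move=> SA; apply: (S_ext (g := fun t => cofactor (A t) b a)) => [t|].
  by rewrite !mxE.
apply: S_mul; first exact: S_cst.
apply: closed_det => k l.
by apply: S_ext (SA (lift b k) (lift a l)) => t; rewrite !mxE.
Qed.

Lemma ncfrac_closed C d (iota : C -> P) n (Y : T -> 'I_d -> 'M[P]_n)
    (h : T -> 'I_d -> P)
    (SY : forall j a b, S (fun t => Y t j a b)) (Sh : forall j, S (h^~ j))
    p q (e : ncrat C d p q) :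
  S (fun t => (ncfrac iota (Y t) (h t) e).1) /\
  forall a b, S (fun t => (ncfrac iota (Y t) (h t) e).2 a b).
Proof.
elim: e => /=.
- move=> p' q' M; split; first exact: S_cst.
  by move=> a b; apply: S_cst.
- move=> p' q' M j; split=> [|a b]; first exact: Sh.
  apply: (S_ext (g := fun t =>
    map_mx iota M (mxtens_unindex a).1 (mxtens_unindex b).1 *
    Y t j (mxtens_unindex a).2 (mxtens_unindex b).2)) => [t|].
    by rewrite mxE.
  exact: S_mul.
- move=> p' q' e1 [S1 S1'] e2 [S2 S2']; split=> [|a b]; first exact: S_mul.
  have := S_add (S_mul S2 (S1' a b)) (S_mul S1 (S2' a b)).
  by apply: S_ext => t; rewrite !mxE.
- move=> p' q' r e1 [S1 S1'] e2 [S2 S2']; split=> [|a b]; first exact: S_mul.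
  exact: closed_mulmx.
- move=> p' e1 [S1 S1']; split=> [|a b].
    by apply: S_mul => //; apply: closed_det.
  have := S_mul (S_mul S1 S1) (closed_adj a b S1').
  by apply: S_ext => t; rewrite mxE expr2.
Qed.

End closed_function_classes.

(** The inverse of [x.2 / x.1] is [x.1 ^+ 2 *: \adj x.2] over [x.1 * \det x.2]. The uncancelled
    factor [x.1] keeps the domain conditions of the subexpressions in the denominator. *)
Lemma ncfracP C d (K : fieldType) (iota : C -> K) n (Y : 'I_d -> 'M[K]_n)
    (h : 'I_d -> K) (h0 : forall j, h j != 0) p q (e : ncrat C d p q) :
  let X := fun j => (h j)^-1 *: Y j in
  let x := ncfrac iota Y h e in
  mxdom iota X e = (x.1 != 0) /\
  (x.1 != 0 -> x.1 *: mxeval iota X e = x.2).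
Proof.
elim: e => /=.
- by move=> p' q' M; rewrite oner_neq0; split=> // _; rewrite scale1r.
- move=> p' q' M j; rewrite h0; split=> // _.
  by apply/matrixP => a b; rewrite !mxE mulrCA mulVKf.
- move=> p' q' e1 [-> E1] e2 [-> E2]; rewrite mulf_eq0 negb_or; split=> //.
  case/andP=> /E1 H1 /E2 H2; rewrite -H1 -H2 scalerDr !scalerA.
  by rewrite [X in X *: _ + _]mulrC.
- move=> p' q' r e1 [-> E1] e2 [-> E2]; rewrite mulf_eq0 negb_or; split=> //.
  by case/andP=> /E1 H1 /E2 H2; rewrite -H1 -H2 -scalemxAl -scalemxAr scalerA.
- move=> p' e1 [-> E1]; rewrite mulf_eq0 negb_or; split.
    case: eqVneq => //= a0.
    by rewrite -(E1 a0) detZ mulf_eq0 negb_or expf_neq0 //= unitmxE unitfE.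
  case/andP=> a0 D0; have H1 := E1 a0.
  have U : (ncfrac iota Y h e1).2 \in unitmx by rewrite unitmxE unitfE.
  have -> : mxeval iota (fun j => (h j)^-1 *: Y j) e1 =
      (ncfrac iota Y h e1).1^-1 *: (ncfrac iota Y h e1).2.
    by rewrite -H1 scalerA mulVf// scale1r.
  rewrite invmxZ ?unitmxZ ?unitfE ?invr_eq0// invrK scalerA /invmx U scalerA.
  by rewrite mulrAC mulfK// expr2.
Qed.

Lemma tensmx11 (P : comNzRingType) p n :
  (1%:M : 'M[P]_p) *t (1%:M : 'M[P]_n) = 1%:M.
Proof.
apply/matrixP => i j; case: (mxtens_indexP i) => a b.
case: (mxtens_indexP j) => a' b'; rewrite tensmxE !mxE.
by rewrite (can_eq (@mxtens_indexK _ _)) xpair_eqE -natrM mulnb.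
Qed.

Lemma tens1mx_mul (P : comNzRingType) p n m l
    (A : 'M[P]_(n, m)) (B : 'M[P]_(m, l)) :
  ((1%:M : 'M[P]_p) *t A) *m ((1%:M : 'M[P]_p) *t B) = 1%:M *t (A *m B).
Proof. by rewrite tensmx_mul mulmx1. Qed.

(** * Intertwiners and direct sums *)

Section intertwiners.
Context {C : Type} {d : nat} (K : fieldType) (iota : C -> K).

(** For an inverse, [A S = S B] with [A] and [B] invertible gives [A^-1 S = S B^-1]. A rectangular
    [J] covers the inclusions of direct summands. *)
Lemma mxeval_intertwine n m (X : 'I_d -> 'M[K]_n) (Y : 'I_d -> 'M[K]_m)
    (J : 'M[K]_(n, m)) (XJ : forall j, X j *m J = J *m Y j)
    p q (e : ncrat C d p q) :
  mxdom iota X e -> mxdom iota Y e ->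
  mxeval iota X e *m (1%:M *t J) = (1%:M *t J) *m mxeval iota Y e.
Proof.
elim: e => /=.
- by move=> p' q' M _ _; rewrite !tensmx_mul !mulmx1 !mul1mx.
- by move=> p' q' M j _ _; rewrite !tensmx_mul mulmx1 mul1mx XJ.
- move=> p' q' e1 IH1 e2 IH2 /andP[? ?] /andP[? ?].
  by rewrite mulmxDl mulmxDr IH1// IH2.
- move=> p' q' r e1 IH1 e2 IH2 /andP[? ?] /andP[? ?].
  by rewrite -mulmxA IH2// mulmxA IH1// mulmxA.
- move=> p' e1 IH1 /andP[dX uX] /andP[dY uY].
  apply: (can_inj (mulKmx uX)); rewrite mulmxA mulmxV// mul1mx.
  by rewrite mulmxA IH1// -mulmxA mulmxV// mulmx1.
Qed.

Section direct_sum.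
Context (n1 n2 : nat) (X1 : 'I_d -> 'M[K]_n1) (X2 : 'I_d -> 'M[K]_n2).

Definition dsum (j : 'I_d) : 'M[K]_(n1 + n2) := block_mx (X1 j) 0 0 (X2 j).

Let inj1 : 'M[K]_(n1 + n2, n1) := col_mx 1%:M 0.
Let inj2 : 'M[K]_(n1 + n2, n2) := col_mx 0 1%:M.
Let prj1 : 'M[K]_(n1, n1 + n2) := row_mx 1%:M 0.
Let prj2 : 'M[K]_(n2, n1 + n2) := row_mx 0 1%:M.

Let dsum_inj1 j : dsum j *m inj1 = inj1 *m X1 j.
Proof.
rewrite /dsum /inj1 mul_block_col mul_col_mx.
by rewrite !mulmx1 !mulmx0 mul1mx !mul0mx !addr0.
Qed.

Let dsum_inj2 j : dsum j *m inj2 = inj2 *m X2 j.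
Proof.
rewrite /dsum /inj2 mul_block_col mul_col_mx.
by rewrite !mulmx1 !mulmx0 mul1mx !mul0mx !add0r.
Qed.

Let inj_prj : inj1 *m prj1 + inj2 *m prj2 = 1%:M.
Proof.
rewrite /inj1 /inj2 /prj1 /prj2 !mul_col_row ?mulmx1 ?mul1mx ?mulmx0 ?mul0mx.
by rewrite add_block_mx ?addr0 ?add0r -scalar_mx_block.
Qed.

Lemma mxdom_dsum p q (e : ncrat C d p q) :
  mxdom iota X1 e -> mxdom iota X2 e -> mxdom iota dsum e.
Proof.
elim: e => //=.
- by move=> p' q' e1 IH1 e2 IH2 /andP[? ?] /andP[? ?]; rewrite IH1// IH2.
- by move=> p' q' r e1 IH1 e2 IH2 /andP[? ?] /andP[? ?]; rewrite IH1// IH2.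
- move=> p' e1 IH1 /andP[d1 u1] /andP[d2 u2]; rewrite IH1//=.
  have E1 := mxeval_intertwine dsum_inj1 (IH1 d1 d2) d1.
  have E2 := mxeval_intertwine dsum_inj2 (IH1 d1 d2) d2.
  (* The inverse acts on each summand by the inverse of the value there. *)
  suff : mxeval iota dsum e1 *m
    ((1%:M *t inj1) *m invmx (mxeval iota X1 e1) *m (1%:M *t prj1) +
     (1%:M *t inj2) *m invmx (mxeval iota X2 e1) *m (1%:M *t prj2)) = 1%:M.
    by case/mulmx1_unit.
  rewrite mulmxDr !mulmxA E1 E2 !mulmxK//.
  rewrite !tens1mx_mul -tensmx11 -inj_prj.
  by apply/matrixP => i j; rewrite !mxE mulrDr.
Qed.

(** Compressing the value at the direct sum by the projections and injections leaves the block
    diagonal matrix of the two values, and compression cannot raise the rank. *)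
Lemma rank_mxeval_dsum p q (e : ncrat C d p q) :
  mxdom iota X1 e -> mxdom iota X2 e ->
  (\rank (mxeval iota X1 e) + \rank (mxeval iota X2 e) <=
   \rank (mxeval iota dsum e))%N.
Proof.
move=> d1 d2; have ds := mxdom_dsum d1 d2.
have E1 := mxeval_intertwine dsum_inj1 ds d1.
have E2 := mxeval_intertwine dsum_inj2 ds d2.
rewrite -rank_diag_block_mx.
have -> : block_mx (mxeval iota X1 e) 0 0 (mxeval iota X2 e) =
  col_mx (1%:M *t prj1) (1%:M *t prj2) *m mxeval iota dsum e *m
  row_mx (1%:M *t inj1) (1%:M *t inj2).
  rewrite -mulmxA mul_mx_row E1 E2 mul_col_row !mulmxA !tens1mx_mul.
  rewrite /inj1 /inj2 /prj1 /prj2 !mul_row_col ?mulmx1 ?mul1mx ?mulmx0 ?mul0mx.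
  by rewrite ?addr0 ?add0r !tensmx11 !mul1mx !tensmx0 !mul0mx.
by apply: leq_trans (mxrankM_maxl _ _) (mxrankM_maxr _ _).
Qed.

End direct_sum.
End intertwiners.

(** * A cyclic division algebra *)

Section skew_matrices.
Context (C : fieldType) (n' : nat).
Local Notation N := n'.+1.
Context (z : C) (z_prim : N.-primitive_root z).
Local Notation P := {poly {poly C}}.

Definition twistx i : {poly C} -> {poly C} := comp_poly (z ^+ i *: 'X).
HB.instance Definition _ i := GRing.RMorphism.on (twistx i).
(** This is the [i]-th power of the automorphism [sigma]; it fixes [t]. *)
Definition twist i : P -> P := map_poly (twistx i).
HB.instance Definition _ i := GRing.RMorphism.on (twist i).

Lemma twistxD i j q : twistx i (twistx j q) = twistx (i + j) q.
Proof.
rewrite /twistx -comp_polyA; congr (_ \Po _).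
by rewrite comp_polyZ comp_polyX scalerA -exprD addnC.
Qed.

Lemma twistD i j q : twist i (twist j q) = twist (i + j) q.
Proof.
by apply/polyP => k; rewrite !coef_map_id0 ?raddf0// twistxD.
Qed.

Lemma twistN q : twist N q = q.
Proof.
apply/polyP => k; rewrite coef_map_id0 ?raddf0//.
by rewrite /twistx (prim_expr_order z_prim) scale1r comp_polyXr.
Qed.

Lemma twist0 q : twist 0 q = q.
Proof.
apply/polyP => k; rewrite coef_map_id0 ?raddf0//.
by rewrite /twistx expr0 scale1r comp_polyXr.
Qed.

Lemma twist1_neq0 q : q != 0 -> twist 1 q != 0.
Proof.
apply: contra => /eqP/(congr1 (twist n')); rewrite twistD addn1 twistN => ->.
by rewrite rmorph0.
Qed.

Lemma twistx_eq0 i q : (twistx i q == 0) = (q == 0).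
Proof.
apply: comp_poly2_eq0; rewrite size_scale ?size_polyX// expf_neq0//.
apply/eqP => z0; have := prim_expr_order z_prim; rewrite z0 expr0n /= => /eqP.
by rewrite eq_sym oner_eq0.
Qed.

(* In [P] the outer variable ['X] plays the role of [t] and the inner one that
   of [x]. *)
Definition tshift : 'M[P]_N :=
  \matrix_(i, j) ((i.+1 == j)%:R + (i.+1 == N + j)%N%:R * 'X).

(** For [k <= N] an index wraps around at most once, and a wrap contributes a factor [t]. *)
Lemma tshiftX k i j : (k <= N)%N ->
  (tshift ^+ k) i j = (i + k == j)%N%:R + (i + k == N + j)%N%:R * 'X.
Proof.
elim: k i j => [|k IH] i j kN.
  rewrite expr0 !mxE addn0 val_eqE (ltn_eqF (ltn_addr j (ltn_ord i))).
  by rewrite mul0r addr0.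
rewrite exprSr !mxE.
have -> : \sum_l (tshift ^+ k) i l * tshift l j =
  \sum_(l < N) (((i + k == l)%N%:R + (i + k == N + l)%N%:R * 'X) *
    ((l.+1 == j)%N%:R + (l.+1 == N + j)%N%:R * 'X)) :> P.
  by apply: eq_bigr => l _; rewrite IH 1?ltnW// !mxE.
have i_lt := ltn_ord i; have j_lt := ltn_ord j.
have [ikN|Nik] := ltnP (i + k) N.
  rewrite (bigD1 (Ordinal ikN))//= big1 ?addr0.
    by rewrite eqxx addnS (ltn_eqF (ltn_addr (i + k) ikN)) mul0r addr0 mul1r.
  move=> l; rewrite -val_eqE /= eq_sym => /negbTE ->.
  by rewrite (ltn_eqF (ltn_addr l ikN)) mul0r addr0 mul0r.
have ikN : (i + k - N < N)%N by lia.
rewrite (bigD1 (Ordinal ikN))//= big1 ?addr0.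
  rewrite subnKC// eqxx mul1r (gtn_eqF (leq_trans ikN Nik)) add0r.
  have -> : ((i + k - N).+1 == j)%N = (i + k.+1 == N + j)%N by lia.
  have ikN1 : ((i + k - N).+1 < N)%N by lia.
  rewrite (ltn_eqF (ltn_addr j ikN1)).
  rewrite mul0r addr0 mulrC [in RHS]gtn_eqF ?add0r//.
  by lia.
move=> l lN; rewrite (gtn_eqF (leq_trans (ltn_ord l) Nik)) add0r.
have -> : (i + k == N + l)%N = false; last by rewrite !mul0r.
apply: contra_neqF lN => /eqP E; apply/val_inj; by rewrite /= E addKn.
Qed.

Lemma tshiftN : tshift ^+ N = 'X%:M.
Proof.
apply/matrixP => i j; rewrite tshiftX// !mxE.
rewrite gtn_eqF ?add0r; last by rewrite ltn_addl.
by rewrite addnC eqn_add2l val_eqE mulr_natl.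
Qed.

Lemma det_tshift_neq0 : \det tshift != 0.
Proof.
have detX k : \det (tshift ^+ k) = \det tshift ^+ k.
  by elim: k => [|k IH]; rewrite ?det1// !exprS det_mulmx IH.
have := detX N; rewrite tshiftN det_scalar => E.
apply: contra_eq_neq E => ->; rewrite [in X in _ != X]expr0n /=.
by rewrite expf_neq0// polyX_eq0.
Qed.

Lemma row_tshift i : row i tshift =
  if (i.+1 < N)%N then delta_mx 0 (inord i.+1) else 'X *: delta_mx 0 0.
Proof.
apply/rowP => j; rewrite mxE mxE; have j_lt := ltn_ord j.
case: ltnP => iN; rewrite !mxE eqxx /=.
  rewrite (ltn_eqF (ltn_addr j iN)) mul0r addr0 -val_eqE /= inordK//.
  by rewrite eq_sym.
have -> : i.+1 = N by apply/eqP; rewrite eqn_leq iN ltn_ord.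
rewrite gtn_eqF// add0r -{1}[N]addn0 eqn_add2l mulrC eq_sym.
by [].
Qed.

Lemma twist_tshift i : map_mx (twist i) tshift = tshift.
Proof.
apply/matrixP => a b; rewrite !mxE rmorphD rmorphM !rmorph_nat.
by rewrite /= /twist map_polyX.
Qed.

Lemma twist_tshiftX i k : map_mx (twist i) (tshift ^+ k) = tshift ^+ k.
Proof. by rewrite rmorphXn /= twist_tshift. Qed.

(** In the cyclic algebra with [v f = sigma(f) v] and [v^N = t], this is the matrix of right
    multiplication by [sum_l w_l v^l] in the basis of the powers of [v]: row [i] holds the
    coordinates of [v^i] times that element. *)
Definition skew_mx (w : 'rV[P]_N) : 'M[P]_N :=
  \matrix_i (map_mx (twist i) w *m tshift ^+ i).

(** Left multiplication by [v], which is semilinear with matrix [tshift], commutes with right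
    multiplications. *)
Lemma skew_mx_comm w :
  tshift *m skew_mx w = map_mx (twist 1) (skew_mx w) *m tshift.
Proof.
apply/row_matrixP => i; rewrite !row_mul -map_row rowK map_mxM twist_tshiftX.
rewrite -map_mx_comp (eq_map_mx _ (twistD 1 i)) -mulmxA.
rewrite [X in _ = _ *m X](_ : _ = tshift ^+ i.+1); last by rewrite exprSr.
(* The last row wraps around: both sides are then [t w], since [v^N = t] and [sigma^N] is the
   identity. *)
rewrite row_tshift; case: ltnP => iN.
  by rewrite -rowE rowK inordK.
rewrite -scalemxAl -rowE rowK expr0 mulmx1.
have -> : i.+1 = N by apply/eqP; rewrite eqn_leq iN ltn_ord.
rewrite tshiftN mul_mx_scalar add1n.
have -> : i.+1 = N by apply/eqP; rewrite eqn_leq iN ltn_ord.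
by rewrite (eq_map_mx _ twistN) (eq_map_mx _ twist0).
Qed.

Lemma skew_mx_tshift w : skew_mx (w *m tshift) = skew_mx w *m tshift.
Proof.
apply/row_matrixP => i; rewrite row_mul !rowK map_mxM twist_tshift -!mulmxA.
by congr (_ *m _); rewrite -[LHS]exprS -[RHS]exprSr.
Qed.

Lemma skew_mxE (w : 'rV[P]_N) (i j : 'I_N) : skew_mx w i j =
  \sum_l twist i (w 0 l) * ((l + i == j)%N%:R + (l + i == N + j)%N%:R * 'X).
Proof.
rewrite mxE -[LHS]/((map_mx (twist i) w *m tshift ^+ i) 0 j) mxE.
by apply: eq_bigr => l _; rewrite tshiftX 1?ltnW// mxE.
Qed.

Lemma det_skew_mx_base (w : 'rV[P]_N) :
  (w 0 0)`_0 != 0 -> \det (skew_mx w) != 0.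
Proof.
move=> w0; have : \det (map_mx (horner_eval (0 : {poly C})) (skew_mx w)) != 0.
  have E i j : map_mx (horner_eval (0 : {poly C})) (skew_mx w) i j =
      \sum_l twistx i (w 0 l)`_0 * (l + i == j)%N%:R.
    rewrite mxE skew_mxE rmorph_sum; apply: eq_bigr => l _ /=.
    rewrite rmorphM rmorphD rmorphM /= !rmorph_nat /horner_eval hornerX.
    by rewrite mulr0 addr0 horner_coef0 coef_map_id0 ?raddf0.
  rewrite -det_tr det_trig; last first.
    apply/is_trig_mxP => i j ij; rewrite mxE E big1// => l _.
    by rewrite gtn_eqF ?mulr0// ltn_addl.
  apply/prodf_neq0 => i _; rewrite mxE E (bigD1 ord0)//= add0n eqxx mulr1.
  rewrite big1 ?addr0 ?twistx_eq0// => l l0.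
  rewrite (_ : (l + i == i)%N = false) ?mulr0//.
  by move: l0; rewrite -val_eqE /=; lia.
by rewrite det_map_mx; apply: contraNneq => ->; rewrite rmorph0.
Qed.

(* If the constant coefficient of [w 0 0] is nonzero then [skew_mx w] is
   triangular modulo [t].  Otherwise [w] can be divided by [tshift], which
   decreases [N * (power of t) + column] for each of its coefficients. *)
Lemma det_skew_mx_neq0 (w : 'rV[P]_N) : w != 0 -> \det (skew_mx w) != 0.
Proof.
case/rV0Pn => j wj0.
have [m] : exists m, (w 0 j)`_m != 0.
  by exists (size (w 0 j)).-1; rewrite -lead_coefE lead_coef_eq0.
move: {2}(N * m + j)%N (erefl (N * m + j)%N) => k.
elim: k => [|k IH] in w m j wj0 * => E nz.
  apply: det_skew_mx_base; move: nz; have -> : m = 0%N by lia.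
  by congr ((w 0 _)`_0 != 0); apply/val_inj => /=; lia.
have [w00|] := eqVneq (w 0 0)`_0 0; last exact: det_skew_mx_base.
(* Division by [tshift] moves column [l + 1] to column [l]; column 0, whose constant coefficient
   vanishes, is divided by [t] and becomes the last column. *)
pose w' := \row_(l < N) if (l.+1 < N)%N then w 0 (inord l.+1)
                        else drop_poly 1 (w 0 0).
have Ew : w = w' *m tshift.
  apply/rowP => l; rewrite mxE.
  have [l0|l0] := posnP l.
    have -> : l = 0 by apply/val_inj.
    rewrite (bigD1 ord_max)//= big1 => [|b bmax].
      rewrite !mxE /= ltnn [X in _ * X](_ : _ = 'X) ?addr0; last first.
        by rewrite /= addn0 eqxx mul1r add0r.
      rewrite -{1}(poly_take_drop 1 (w 0 0)) expr1.
      rewrite [take_poly _ _](_ : _ = 0) ?add0r//.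
      by apply/polyP => b; rewrite coef_take_poly coef0; case: b.
    have bN : (b.+1 < N)%N.
      by have := ltn_ord b; move: bmax; rewrite -val_eqE /=; lia.
    by rewrite !mxE /= addn0 (ltn_eqF bN) mul0r addr0 mulr0.
  have lN := ltn_ord l.
  have l1N : (l.-1 < N)%N by lia.
  rewrite (bigD1 (Ordinal l1N))//= big1 => [|b bl].
    rewrite !mxE /= prednK// lN eqxx (ltn_eqF (ltn_addr l lN)) mul0r !addr0.
    by rewrite mulr1 inord_val.
  rewrite !mxE; have -> : (b.+1 == l)%N = false.
    by move: bl; rewrite -val_eqE /=; lia.
  have -> : (b.+1 == N + l)%N = false by have := ltn_ord b; lia.
  by rewrite mul0r addr0 mulr0.
rewrite Ew skew_mx_tshift det_mulmx mulf_neq0 ?det_tshift_neq0//.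
have [j0|j0] := posnP j.
  have m0 : (0 < m)%N by lia.
  have nz' : (w' 0 ord_max)`_m.-1 != 0.
    rewrite mxE /= ltnn coef_drop_poly addn1 prednK//.
    by rewrite (_ : 0 = j)//; apply/val_inj.
  apply: (IH w' m.-1 ord_max _ _ nz').
    by apply: contraNneq nz' => ->; rewrite coef0.
  by rewrite /=; nia.
have jN := ltn_ord j; have j1N : (j.-1 < N)%N by lia.
have nz' : (w' 0 (Ordinal j1N))`_m != 0.
  by rewrite mxE /= prednK// jN inord_val.
apply: (IH w' m (Ordinal j1N) _ _ nz').
  by apply: contraNneq nz' => ->; rewrite coef0.
by rewrite /=; lia.
Qed.

(** Lagrange interpolation at the powers of [z], which are distinct because [z] is primitive. *)
Lemma interpolation (c : 'I_N -> C) :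
  exists q : {poly C}, forall i : 'I_N, q.[z ^+ i] = c i.
Proof.
exists (\sum_k c k *:
  \prod_(l < N | l != k) ((z ^+ k - z ^+ l)^-1 *: ('X - (z ^+ l)%:P))).
move=> i; rewrite horner_sum (bigD1 i)//= [X in _ + X]big1 => [|k ki].
  rewrite addr0 hornerZ horner_prod big1 ?mulr1// => l li.
  rewrite hornerZ hornerXsubC mulVf// subr_eq0.
  by rewrite (eq_prim_root_expr z_prim) !modn_small// eq_sym.
rewrite hornerZ horner_prod (bigD1 i) 1?eq_sym//= hornerZ hornerXsubC subrr.
by rewrite mulr0 mul0r mulr0.
Qed.

Definition eval_at_one : P -> C := horner_eval 1 \o horner_eval 1.
HB.instance Definition _ := GRing.RMorphism.on eval_at_one.

(** At [t = x = 1] the entry [(i, j)] of [skew_mx w] is the value at [z^i] of the one coefficient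
    [w_l] with [l = j - i] modulo [N], so interpolation prescribes all entries independently. *)
Lemma skew_lift (W : 'M[C]_N) : exists w, map_mx eval_at_one (skew_mx w) = W.
Proof.
have [q qP] := choice (fun l : 'I_N =>
  interpolation (fun i => W i (inord ((l + i) %% N)))).
exists (\row_l (q l)%:P); apply/matrixP => i j.
rewrite mxE skew_mxE rmorph_sum.
transitivity (\sum_(l < N) W i j * (l + i == j %[mod N])%N%:R).
  apply: eq_bigr => l _; rewrite mxE rmorphM rmorphD rmorphM !rmorph_nat.
  rewrite /= /eval_at_one /= /horner_eval hornerX hornerC mulr1.
  rewrite /twist map_polyC/= hornerC.
  rewrite /twistx horner_comp hornerZ hornerX mulr1 qP -natrD.
  have := ltn_ord l; have := ltn_ord i; have := ltn_ord j => jN iN lN.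
  rewrite (modn_small jN).
  have -> : ((l + i == j) + (l + i == N + j) = ((l + i) %% N == j))%N.
    have [s|s] := ltnP (l + i) N.
      by rewrite modn_small// (ltn_eqF (ltn_addr j s)) addn0.
    rewrite -[in RHS](subnK s) modnDr modn_small; last by lia.
    by rewrite gtn_eqF ?add0n; [congr nat_of_bool; lia | lia].
  by case: eqP => [->|_]; rewrite ?inord_val ?mulr0.
rewrite -mulr_sumr.
have jN : ((j + (N - i)) %% N < N)%N by rewrite ltn_mod.
rewrite (bigD1 (Ordinal jN))//= big1 => [|l lj].
  rewrite modnDml -addnA subnK 1?ltnW// modnDr eqxx addr0 mulr1//.
case: eqP => // E; case/eqP: lj; apply/val_inj.
rewrite /= -modnDml -E modnDml -addnA subnKC 1?ltnW//.
by rewrite modnDr modn_small.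
Qed.

Lemma sum_mxtens (V : nmodType) m n (F : 'I_(m * n) -> V) :
  \sum_k F k = \sum_a \sum_b F (mxtens_index (a, b)).
Proof.
rewrite pair_bigA (reindex (@mxtens_index m n))/=.
  by apply: eq_bigr => -[].
exists (@mxtens_unindex m n) => k _; first exact: mxtens_indexK.
exact: mxtens_unindexK.
Qed.

Definition row_block (T : Type) m n (b : 'I_m) (w : 'rV[T]_(m * n)) :
    'rV[T]_n :=
  \row_j w 0 (mxtens_index (b, j)).

Lemma row_block_tens1 m n (b : 'I_m) (w : 'rV[P]_(m * n)) (A : 'M[P]_n) :
  row_block b (w *m (1%:M *t A)) = row_block b w *m A.
Proof.
apply/rowP => j; rewrite !mxE sum_mxtens (bigD1 b)//=.
rewrite [X in _ + X]big1 ?addr0 => [|a ab].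
  by apply: eq_bigr => l _; rewrite tensmxE !mxE eqxx mul1r.
by apply: big1 => l _; rewrite tensmxE !mxE (negbTE ab) mul0r mulr0.
Qed.

Local Notation L := {fraction {poly {poly C}}}.

(* The images [u i] of one left null vector [w] of [M] are again left null
   vectors; they are independent because a nonzero block of [w] gives rise to
   an invertible [skew_mx]. *)
Lemma skew_rank m (M : 'M[P]_(m * N)) (a b : P) :
  a != 0 ->
  a *: ((1%:M *t tshift) *m M) =
    b *: (map_mx (twist 1) M *m (1%:M *t tshift)) ->
  \det M = 0 -> (\rank (map_mx (@tofrac _ : P -> L) M) + N <= m * N)%N.
Proof.
move=> a0 aM /eqP/det0P[w w0 wM].
have [b0 bw] : exists b0, row_block b0 w != 0.
  case/rV0Pn: w0 => k; case: (mxtens_indexP k) => b0 j wk.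
  by exists b0; apply/rV0Pn; exists j; rewrite mxE.
pose u i := map_mx (twist i) w *m (1%:M *t (tshift ^+ i)).
have uS i : u i.+1 = map_mx (twist 1) (u i) *m (1%:M *t tshift).
  rewrite /u map_mxM map_mxT map_mx1 twist_tshiftX -mulmxA tensmx_mul mulmx1.
  by rewrite -[tshift ^+ i *m _]exprSr -map_mx_comp (eq_map_mx _ (twistD 1 i)).
have uM i : u i *m M = 0.
  elim: i => [|i IH].
    rewrite /u (eq_map_mx _ twist0) (map_mx_id (frefl _)) expr0 tensmx11.
    by rewrite mulmx1.
  (* Up to the nonzero factor [a], the product of [u i.+1] and [M] is [b sigma(u i M) v], which
     vanishes by induction. *)
  apply/eqP; rewrite -(inj_eq (scalemx_inj a0)) scaler0 uS -mulmxA scalemxAr aM.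
  by rewrite -scalemxAr mulmxA -map_mxM IH map_mx0 mul0mx scaler0.
pose V : 'M[P]_(N, m * N) := \matrix_i u i.
have VM : V *m M = 0 by apply/row_matrixP => i; rewrite row_mul rowK uM row0.
pose f (j : 'I_N) : 'I_(m * N) := mxtens_index (b0, j).
have EV : colsub f V = skew_mx (row_block b0 w).
  apply/row_matrixP => i; rewrite rowK.
  have -> : map_mx (twist i) (row_block b0 w) =
      row_block b0 (map_mx (twist i) w).
    by apply/rowP => j; rewrite !mxE.
  by rewrite -row_block_tens1; apply/rowP => j; rewrite !mxE.
have rV : (N <= \rank (map_mx (@tofrac _ : P -> L) V))%N.
  have := mxrankM_maxl (map_mx (@tofrac _ : P -> L) V) (colsub f 1%:M).
  rewrite mulmx_colsub mulmx1 -map_mxsub EV mxrank_unit//.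
  by rewrite unitmxE det_map_mx unitfE tofrac_eq0 det_skew_mx_neq0.
have := @mulmx0_rank_max L _ _ _ (map_mx (@tofrac _) V) (map_mx (@tofrac _) M).
rewrite -map_mxM VM map_mx0 => /(_ erefl).
by apply: leq_trans; rewrite addnC leq_add2r.
Qed.

End skew_matrices.

(** * Roots of unity, polynomial functions and specialization of rank *)

Lemma prim_root_exists (C : numClosedFieldType) n :
  (n > 0)%N -> exists z : C, n.-primitive_root z.
Proof.
move=> n_gt0; have [r] := closed_field_poly_normal ('X^n - 1 : {poly C}).
rewrite (monicP _) ?monicXnsubC// scale1r => Dr.
have size_r : size r = n.
  by apply/eqP; rewrite -eqSS -(size_prod_XsubC r id) -Dr size_XnsubC.
(* [X^n - 1] is separable in characteristic zero, so its [n] roots are distinct; [n] distinct [n]-th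
   roots of unity include a primitive one. *)
suff /hasP[z _ ?] : has n.-primitive_root r by exists z.
apply: has_prim_root => //.
- by apply/allP => z; rewrite -root_prod_XsubC -Dr.
- by rewrite -separable_prod_XsubC -Dr separable_Xn_sub_1// pnatr_eq0 -lt0n.
- by rewrite size_r.
Qed.

Lemma poly_nonroot (K : idomainType) (u : nat -> K) (u_inj : injective u)
    (p : {poly K}) : p != 0 -> exists k, p.[u k] != 0.
Proof.
move=> p0; apply: contrapT => nk.
suff : (size (map u (iota 0 (size p))) < size p)%N.
  by rewrite size_map size_iota ltnn.
apply: max_poly_roots => //; last by rewrite map_inj_uniq// iota_uniq.
apply/allP => x /mapP[k _ ->]; apply: contrapT => /negP r; apply: nk.
by exists k.
Qed.

Lemma natr_inj_num (R : numDomainType) : injective (fun k : nat => k%:R : R).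
Proof. by move=> i j /eqP; rewrite eqr_nat => /eqP. Qed.

(** The parameter enters through [u]: the identity of a field, or the embedding of the reals into
    the complex numbers. *)
Definition polyfun (K : fieldType) (T : Type) (u f : T -> K) :=
  exists p : {poly K}, forall t, f t = p.[u t].

Section polyfun.
Context (K : fieldType) (T : Type) (u : T -> K).
Implicit Types f g : T -> K.

Lemma polyfun_cst (a : K) : polyfun u (fun=> a).
Proof. by exists a%:P => t; rewrite hornerC. Qed.

Lemma polyfunD f g :
  polyfun u f -> polyfun u g -> polyfun u (fun t => f t + g t).
Proof. by move=> [p pf] [q qg]; exists (p + q) => t; rewrite hornerD pf qg. Qed.

Lemma polyfunM f g :
  polyfun u f -> polyfun u g -> polyfun u (fun t => f t * g t).
Proof. by move=> [p pf] [q qg]; exists (p * q) => t; rewrite hornerM pf qg. Qed.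

Lemma polyfun_algebra : function_algebra (polyfun u).
Proof. by split; [exact: polyfun_cst|exact: polyfunD|exact: polyfunM]. Qed.

Lemma polyfun_nonroot (v : nat -> T) (uv_inj : injective (u \o v)) f a :
  polyfun u f -> f a != 0 -> exists k, f (v k) != 0.
Proof.
move=> [p pf] fa; have [|k pk] := @poly_nonroot _ _ uv_inj p.
  by apply: contraNneq fa => p0; rewrite pf p0 horner0.
by exists k; rewrite pf.
Qed.

Lemma polyfun_nonroot2 (v : nat -> T) (uv_inj : injective (u \o v)) f g a b :
  polyfun u f -> polyfun u g -> f a != 0 -> g b != 0 ->
  exists k, f (v k) != 0 /\ g (v k) != 0.
Proof.
move=> [p pf] [q qg]; rewrite pf qg => pa qb.
have [|k] := @poly_nonroot _ _ uv_inj (p * q).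
  rewrite mulf_neq0//; [apply: contraNneq pa => ->|apply: contraNneq qb => ->];
  by rewrite horner0.
rewrite hornerM mulf_eq0 negb_or => /andP[? ?].
by exists k; rewrite pf qg.
Qed.

End polyfun.

Lemma ncfracE (C : Type) (K : fieldType) (iota : C -> K) d n
    (X : 'I_d -> 'M[K]_n) p q (e : ncrat C d p q)
    (x := ncfrac iota X (fun=> 1) e) :
  mxdom iota X e = (x.1 != 0) /\
  (x.1 != 0 -> x.1 *: mxeval iota X e = x.2).
Proof.
have := @ncfracP _ _ _ iota n X (fun=> 1) (fun=> oner_neq0 _) p q e.
rewrite (_ : (fun j => _) = X)//.
by apply/funext => j; rewrite invr1 scale1r.
Qed.

Lemma mxdomE (K : fieldType) d n (X : 'I_d -> 'M[K]_n) p q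
    (e : ncrat K d p q) :
  mxdom id X e = ((ncfrac id X (fun=> 1) e).1 != 0).
Proof. exact: (ncfracE id X e).1. Qed.

(** Constant matrices [U] and [V] that compress the specialization to an identity of size [r] lift
    along [iota]. The compression of [A] by these lifts has a determinant that specializes to 1,
    hence is nonzero. *)
Lemma rank_specialize (C : fieldType) (P : idomainType)
    (iota : {rmorphism C -> P}) (phi : {rmorphism P -> C})
    (iotaK : cancel iota phi) m n (A : 'M[P]_(m, n)) :
  (\rank (map_mx phi A) <= \rank (map_mx (@tofrac P) A))%N.
Proof.
set B := map_mx phi A; set r := \rank B.
have /row_freeP[V VP] : row_free (row_base B) := row_base_free B.
have [U UP] : exists U, U *m col_base B = 1%:M.
  by apply/row_fullP; exact: col_base_full.
have UBV : U *m B *m V = 1%:M.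
  have -> : U *m B = row_base B.
    by rewrite -[RHS]mul1mx -UP -mulmxA mulmx_base.
  exact: VP.
pose D := map_mx iota U *m A *m map_mx iota V.
have D0 : \det D != 0.
  have : phi (\det D) = 1.
    rewrite -det_map_mx /D !map_mxM -!map_mx_comp.
    by rewrite !(eq_map_mx _ iotaK) !(map_mx_id (frefl _)) UBV det1.
  by apply: contra_eqN => /eqP ->; rewrite rmorph0 eq_sym oner_eq0.
have : \rank (map_mx (@tofrac P) D) = r.
  by rewrite mxrank_unit// unitmxE det_map_mx unitfE tofrac_eq0.
rewrite /D !map_mxM => <-.
by apply: leq_trans (mxrankM_maxl _ _) (mxrankM_maxr _ _).
Qed.

Section skew_intertwine.
Context (C : fieldType) (n' : nat) (z : C) (z_prim : n'.+1.-primitive_root z).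
Local Notation P := {poly {poly C}}.
Local Notation N := n'.+1.
Local Notation polyCC := (fun c : C => c%:P%:P : P).

(** Over the fraction field [tshift] intertwines [X] and [sigma(X)], hence also the values of [e].
    As [sigma] fixes [C], the value at [sigma(X)] is the fraction with [sigma] applied to both
    terms; clearing denominators gives the identity. *)
Lemma ncfrac_skew d (X : 'I_d -> 'M[P]_N)
    (Xv : forall j,
      tshift C n' *m X j = map_mx (twist z 1) (X j) *m tshift C n')
    p q (e : ncrat C d p q) (x := ncfrac polyCC X (fun=> 1) e) : x.1 != 0 ->
  twist z 1 x.1 *: ((1%:M *t tshift C n') *m x.2) =
  x.1 *: (map_mx (twist z 1) x.2 *m (1%:M *t tshift C n')).
Proof.
move=> x0; pose L := {fraction P}; pose f : {rmorphism P -> L} := @tofrac _.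
have fI m n (A B : 'M[P]_(m, n)) : map_mx f A = map_mx f B -> A = B.
  move=> /matrixP AB; apply/matrixP => i j; apply/eqP; rewrite -tofrac_eq.
  by have := AB i j; rewrite !mxE => ->.
apply: fI.
rewrite !map_mxZ !map_mxM !map_mxT !map_mx1.
pose iL := (f \o polyCC : C -> L).
pose XL j := map_mx f (X j); pose XL' j := map_mx f (map_mx (twist z 1) (X j)).
have E : ncfrac iL XL (fun=> 1) e = (f x.1, map_mx f x.2).
  exact: (ncfrac_map1 (f := f)).
have Et : ncfrac polyCC (fun j => map_mx (twist z 1) (X j)) (fun=> 1) e =
    (twist z 1 x.1, map_mx (twist z 1) x.2).
  have twC c : (twist z 1 : {rmorphism P -> P}) (polyCC c) = polyCC c.
    by rewrite /= /twist map_polyC /= /twistx comp_polyC.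
  exact: (ncfrac_map1 twC X e).
have E' : ncfrac iL XL' (fun=> 1) e =
    (f (twist z 1 x.1), map_mx f (map_mx (twist z 1) x.2)).
  by rewrite (ncfrac_map1 (f := f) (iota := polyCC))// Et.
have [dX eX] := ncfracE iL XL e; have [dX' eX'] := ncfracE iL XL' e.
rewrite E /= tofrac_eq0 x0 in dX eX; have {}eX := eX isT.
have rx0 := twist1_neq0 z_prim x0.
rewrite E' /= tofrac_eq0 rx0 in dX' eX'; have {}eX' := eX' isT.
have XJ j : XL' j *m map_mx f (tshift C n') = map_mx f (tshift C n') *m XL j.
  by rewrite /XL /XL' -!map_mxM Xv.
rewrite -eX -eX' -scalemxAl -scalemxAr (mxeval_intertwine XJ dX' dX).
by rewrite !scalerA mulrC.
Qed.

End skew_intertwine.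

(** * The domain at large sizes *)

Section all_sizes.
Context (C : numClosedFieldType) (d : nat).
Local Notation P := {poly {poly C}}.
Local Notation polyCC := (polyC \o polyC : C -> P).

Lemma dom_copies p q (e : ncrat C d p q) m (X0 : 'I_d -> 'M[C]_m)
    s (Z : 'I_d -> 'M[C]_s) k n :
  n = (k * m + s)%N -> mxdom id X0 e -> mxdom id Z e ->
  exists2 X : 'I_d -> 'M[C]_n, mxdom id X e &
    (k * \rank (mxeval id X0 e) <= \rank (mxeval id X e))%N.
Proof.
move=> -> dX0 dZ; elim: k => [|k [X dX rX]]; first by exists Z.
rewrite mulSn -addnA; exists (dsum X0 X); first exact: mxdom_dsum.
apply: leq_trans (rank_mxeval_dsum dX0 dX).
by rewrite mulSn leq_add2l.
Qed.

(** On the line through [X] and [X'] the two denominators are polynomials, nonzero at 0 and at 1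
    respectively, so some natural number is a root of neither. *)
Lemma mxdom_common p q p' q' (e : ncrat C d p q) (e' : ncrat C d p' q') n
    (X X' : 'I_d -> 'M[C]_n) : mxdom id X e -> mxdom id X' e' ->
  exists Y : 'I_d -> 'M[C]_n, mxdom id Y e && mxdom id Y e'.
Proof.
pose Y t j := (1 - t) *: X j + t *: X' j.
have pY j a b : polyfun id (fun t => Y t j a b).
  exists ((1 - 'X) * (X j a b)%:P + 'X * (X' j a b)%:P) => t.
  by rewrite !hornerE !mxE.
have pe p0 q0 (e0 : ncrat C d p0 q0) :
    polyfun id (fun t => (ncfrac id (Y t) (fun=> 1) e0).1).
  exact: (ncfrac_closed (polyfun_algebra id) id pY
    (fun=> polyfun_cst id 1) e0).1.
rewrite !mxdomE => dX dX'.
have Y0 : Y 0 = X by apply/funext => j; rewrite /Y subr0 scale1r scale0r addr0.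
have Y1 : Y 1 = X' by apply/funext => j; rewrite /Y subrr scale0r scale1r add0r.
have [||k [k1 k2]] := polyfun_nonroot2 (u := id) (@natr_inj_num C)
  (a := 0) (b := 1) (pe _ _ e) (pe _ _ e').
- by rewrite Y0.
- by rewrite Y1.
by exists (Y k%:R); rewrite !mxdomE k1.
Qed.

Lemma skew_dom p (e : ncrat C d p p) n' (X0 : 'I_d -> 'M[C]_n'.+1) :
  mxdom id X0 e -> (p * n'.+1 < \rank (mxeval id X0 e) + n'.+1)%N ->
  exists X : 'I_d -> 'M[C]_n'.+1, mxdom id X (NCinv e).
Proof.
move=> dX0 rX0; have [z z_prim] := @prim_root_exists C n'.+1 isT.
have [w wX0] := choice (fun j => skew_lift z_prim (X0 j)).
pose X j := skew_mx z (w j); pose x := ncfrac polyCC X (fun=> 1) e.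
have specialize (phi : {rmorphism P -> C}) : cancel polyCC phi ->
  forall p' (e' : ncrat C d p' p'),
  ncfrac id (fun j => map_mx phi (X j)) (fun=> 1) e' =
  (phi (ncfrac polyCC X (fun=> 1) e').1,
   map_mx phi (ncfrac polyCC X (fun=> 1) e').2).
  by move=> phiK p' e'; exact: ncfrac_map1.
have eval_at_oneK : cancel polyCC (@eval_at_one C).
  by move=> c; rewrite /eval_at_one /= /horner_eval !hornerC.
have := specialize (@eval_at_one C) eval_at_oneK _ e.
rewrite (_ : (fun j => _) = X0); last by apply/funext.
rewrite -/x => E; have [_ eX0] := ncfracE id X0 e.
move: dX0; rewrite mxdomE => dX0; have {}eX0 := eX0 dX0; rewrite E/= in dX0 eX0.
have x0 : x.1 != 0 by apply: contraNneq dX0 => ->; rewrite rmorph0.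
(* A singular numerator would have rank at most [p N - N] by [skew_rank], and so would its
   specialization at [X0], against [rX0]. *)
have [D0|D0] := eqVneq (\det x.2) 0.
  have := ncfrac_skew z_prim (fun j => skew_mx_comm z_prim (w j)) x0.
  move=> /(skew_rank z_prim (twist1_neq0 z_prim x0))/(_ D0) H.
  exfalso; suff : (\rank (mxeval id X0 e) <= \rank (map_mx (@tofrac P) x.2))%N.
    move=> le; have := leq_trans rX0 (leq_trans (leq_add le (leqnn _)) H).
    by rewrite ltnn.
  rewrite -(mxrank_scale_nz _ dX0) eX0.
  exact: (rank_specialize (iota := polyCC) eval_at_oneK).
(* The denominator of [e^-1] is thus a nonzero polynomial; natural numbers are substituted first for
   the outer variable, then for the inner one, without making it vanish. *)
have := mulf_neq0 x0 D0 => /(@poly_nonroot {poly C} (fun k => k%:R%:P)).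
case=> [i j /polyC_inj/natr_inj_num//|t].
move=> /(@poly_nonroot C _ (@natr_inj_num C))[y ty].
pose phi : P -> C := horner_eval (y%:R : C) \o horner_eval (t%:R%:P : {poly C}).
exists (fun j => map_mx phi (X j)); rewrite mxdomE specialize//.
by move=> c; rewrite /phi /= /horner_eval !hornerC.
Qed.

Lemma mxdom_all_sizes p q (e : ncrat C d p q) m (X0 : 'I_d -> 'M[C]_m.+1) :
  mxdom id X0 e ->
  exists N0, forall n, (N0 <= n)%N -> exists X : 'I_d -> 'M[C]_n, mxdom id X e.
Proof.
elim: e => /=.
- by move=> ? ? _ _; exists 0%N => n _; exists (fun=> 0).
- by move=> ? ? _ _ _; exists 0%N => n _; exists (fun=> 0).
- move=> p' q' e1 IH1 e2 IH2 /andP[/IH1[N1 H1] /IH2[N2 H2]].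
  exists (maxn N1 N2) => n; rewrite geq_max => /andP[/H1[X1 d1] /H2[X2 d2]].
  exact: mxdom_common d1 d2.
- move=> p' q' r e1 IH1 e2 IH2 /andP[/IH1[N1 H1] /IH2[N2 H2]].
  exists (maxn N1 N2) => n; rewrite geq_max => /andP[/H1[X1 d1] /H2[X2 d2]].
  exact: mxdom_common d1 d2.
- move=> p' e1 IH1 /andP[dX0 uX0]; have [N1 H1] := IH1 dX0.
  (* Below [s] is less than [N1 + m + 1], so this threshold gives [N1 <= n] and [p' s < n]; the
     latter is the rank condition of [skew_dom] after cancelling [k p' (m + 1)]. *)
  exists (p' * (N1 + m.+1) + N1).+1 => -[//|n'] nN.
  pose k := ((n'.+1 - N1) %/ m.+1)%N; pose s := (N1 + (n'.+1 - N1) %% m.+1)%N.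
  have nks : n'.+1 = (k * m.+1 + s)%N.
    by rewrite /k /s addnCA -divn_eq subnKC//; lia.
  have [Z dZ] := H1 s (leq_addr _ _).
  have [X dX rX] := dom_copies nks dX0 dZ.
  apply: (skew_dom dX); rewrite mxrank_unit// in rX.
  have sN : (s < N1 + m.+1)%N by rewrite ltn_add2l ltn_mod.
  apply: leq_trans (leq_add rX (leqnn _)).
  rewrite {1}nks mulnDr mulnCA ltn_add2l.
  apply: leq_ltn_trans (leq_mul (leqnn p') (ltnW sN)) _; lia.
Qed.

End all_sizes.

(** * Flattening matrices over a matrix algebra *)

Section flattening.
Context (K : fieldType) (n : nat).
Local Notation A := 'M[K]_n.+1.

Definition flat_mx p q (M : 'M[A]_(p, q)) : 'M[K]_(p * n.+1, q * n.+1) :=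
  \matrix_(i, j) M (mxtens_unindex i).1 (mxtens_unindex j).1
                   (mxtens_unindex i).2 (mxtens_unindex j).2.

Lemma flat_mxE p q (M : 'M[A]_(p, q)) i a j b :
  flat_mx M (mxtens_index (i, a)) (mxtens_index (j, b)) = M i j a b.
Proof. by rewrite mxE !mxtens_indexK. Qed.

Lemma flat_mx_inj p q : injective (@flat_mx p q).
Proof.
move=> M M' /matrixP E; apply/matrixP => i j; apply/matrixP => a b.
by rewrite -!flat_mxE E.
Qed.

Lemma flat_mx_onto p q (B : 'M[K]_(p * n.+1, q * n.+1)) :
  exists M, flat_mx M = B.
Proof.
exists (\matrix_(i, j) \matrix_(a, b)
  B (mxtens_index (i, a)) (mxtens_index (j, b))).
apply/matrixP => i j; case: (mxtens_indexP i) => i0 i1.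
by case: (mxtens_indexP j) => j0 j1; rewrite flat_mxE !mxE.
Qed.

Lemma flat_mxD p q (M M' : 'M[A]_(p, q)) :
  flat_mx (M + M') = flat_mx M + flat_mx M'.
Proof. by apply/matrixP => i j; rewrite !mxE. Qed.

Lemma flat_mxM p q r (M : 'M[A]_(p, q)) (M' : 'M[A]_(q, r)) :
  flat_mx (M *m M') = flat_mx M *m flat_mx M'.
Proof.
apply/matrixP => i j; case: (mxtens_indexP i) => i0 i1.
case: (mxtens_indexP j) => j0 j1; rewrite flat_mxE !mxE summxE sum_mxtens.
apply: eq_bigr => k _; rewrite mxE; apply: eq_bigr => l _.
by rewrite !flat_mxE.
Qed.

Lemma flat_mx1 p : flat_mx (1%:M : 'M[A]_p) = 1%:M.
Proof.
rewrite -tensmx11; apply/matrixP => i j; rewrite !mxE.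
by case: eqP; rewrite ?mulr1n ?mul1r ?mulr0n ?mul0r ?mxE.
Qed.

(** Over a field a one-sided inverse of a square matrix is two-sided, and flattening is
    injective. *)
Lemma is_inverse_flat_mx p (M B : 'M[A]_p) :
  is_inverse_mx M B <-> flat_mx M *m flat_mx B = 1%:M.
Proof.
rewrite /is_inverse_mx; split=> [[MB _]|E].
  by rewrite -flat_mxM MB flat_mx1.
by split; apply: flat_mx_inj; rewrite flat_mxM flat_mx1// mulmx1C.
Qed.

Lemma ncdomP d (X : 'I_d -> A) p q (e : ncrat K d p q) :
  (ncdom X e <-> mxdom id X e) /\
  (mxdom id X e -> flat_mx (nceval X e) = mxeval id X e).
Proof.
elim: e => /=.
- move=> p' q' M; split=> // _; apply/matrixP => i j.
  by rewrite !mxE.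
- move=> p' q' M k; split=> // _; apply/matrixP => i j.
  by rewrite !mxE.
- move=> p' q' e1 [D1 E1] e2 [D2 E2]; split=> [|/andP[d1 d2]].
    by split=> [[/D1 -> /D2 ->]|/andP[/D1 ? /D2 ?]].
  by rewrite flat_mxD E1// E2.
- move=> p' q' r e1 [D1 E1] e2 [D2 E2]; split=> [|/andP[d1 d2]].
    by split=> [[/D1 -> /D2 ->]|/andP[/D1 ? /D2 ?]].
  by rewrite flat_mxM E1// E2.
- move=> p' e1 [D1 E1].
  have U : mxdom id X e1 ->
    (exists B, is_inverse_mx (nceval X e1) B) <-> mxeval id X e1 \in unitmx.
    move=> d1; split=> [[B /is_inverse_flat_mx]|u1].
      by rewrite E1// => /mulmx1_unit[].
    have [B EB] := flat_mx_onto (invmx (mxeval id X e1)).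
    by exists B; apply/is_inverse_flat_mx; rewrite E1// EB mulmxV.
  split=> [|/andP[d1 u1]].
    split=> [[/D1 d1 /U ->]|/andP[d1 u1]]; rewrite ?d1//.
    by split; [apply/D1 | apply/U].
  (* [inverse_mx] chooses some inverse; by uniqueness it flattens to [invmx]. *)
  have /(xgetPex 0)/is_inverse_flat_mx := (U d1).2 u1.
  rewrite E1// => E; apply: (can_inj (mulKmx u1)).
  by rewrite mulmxV.
Qed.

End flattening.

Definition upd (I : eqType) (T : Type) (Y : I -> T) j (A : T) (k : I) : T :=
  if k == j then A else Y k.

(** * Self-adjoint and unitary points *)

Section matrix_polynomials.
Context (C : numClosedFieldType) (n : nat).

(* [F] is a polynomial function of the entries, i.e., it maps matrices with
   entries in an algebra of functions to that algebra. *)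
Definition polymx (F : 'M[C]_n -> C) :=
  forall (T : Type) (S : (T -> C) -> Prop), function_algebra S ->
  forall A : T -> 'M[C]_n, (forall a b, S (fun t => A t a b)) -> S (F \o A).

Lemma polyfun_line (A B : 'M[C]_n) a b :
  polyfun id (fun t => (A + t *: B) a b).
Proof.
by exists ((A a b)%:P + 'X * (B a b)%:P) => t; rewrite !hornerE !mxE.
Qed.

Definition hermitian (A : 'M[C]_n) := forall i j, A j i = (A i j)^*.

(** Every [W] is [A + i B] with [A] and [B] hermitian. The polynomial [F (A + t B)] is nonzero at
    [t = i], hence at some natural number [t], where the argument is hermitian. *)
Lemma polymx_hermitian F W : polymx F -> F W != 0 ->
  exists2 A, hermitian A & F A != 0.
Proof.
move=> pF FW.
pose W' : 'M[C]_n := \matrix_(i, j) (W j i)^*.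
pose A := 2^-1 *: (W + W'); pose B := (2^-1 * 'i) *: (W' - W).
have two0 : 2 != 0 :> C by rewrite pnatr_eq0.
have EW : A + 'i *: B = W.
  rewrite /A /B scalerA mulrCA -expr2 sqrCi mulrN1 scaleNr -scalerBr.
  rewrite opprB addrACA subrr addr0 -mulr2n -scaler_nat scalerA mulVf//.
  by rewrite scale1r.
have [|k Fk] := polyfun_nonroot (u := id) (@natr_inj_num C) (a := 'i)
    (pF _ _ (polyfun_algebra _) _ (polyfun_line A B)).
  by rewrite /= EW.
exists (A + k%:R *: B) => // i j; rewrite !mxE.
rewrite !(rmorphD, rmorphM, rmorphB, rmorphN) /= fmorphV !rmorph_nat.
by rewrite conjCi !conjCK; ring.
Qed.

(** Eigenvalues of a hermitian matrix are real: if [v A = - i v], the real number [s], the inner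
    product of [v A] with [v], equals [- i r] with [r] the squared norm of [v]. *)
Lemma hermitian_shift_unit A : hermitian A -> \det (A + 'i%:M) != 0.
Proof.
move=> hA; apply/negP => /det0P[v v0]; rewrite mulmxDr mul_mx_scalar => /eqP.
rewrite addr_eq0 => /eqP vA.
pose r := \sum_k v 0 k * (v 0 k)^*.
have r0 : r != 0.
  apply: contraNneq v0 => /eqP.
  rewrite psumr_eq0 => [|k _]; last exact: mul_conjC_ge0.
  move=> /allP H; apply/eqP/rowP => k; rewrite mxE.
  by have := H k (mem_index_enum _); rewrite mul_conjC_eq0 => /eqP.
pose s := \sum_k (v *m A) 0 k * (v 0 k)^*.
have sE : s = - 'i * r.
  by rewrite /s vA mulr_sumr; apply: eq_bigr => k _; rewrite !mxE !mulNr mulrA.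
have sC : s^* = s.
  transitivity (\sum_k \sum_l (v 0 l * A l k)^* * v 0 k).
    rewrite /s rmorph_sum; apply: eq_bigr => k _.
    by rewrite rmorphM /= conjCK mxE rmorph_sum mulr_suml.
  rewrite exchange_big; apply: eq_bigr => l _ /=; rewrite mxE mulr_suml.
  by apply: eq_bigr => k _; rewrite rmorphM /= -(hA l k); ring.
have rC : r^* = r.
  rewrite rmorph_sum; apply: eq_bigr => k _.
  by rewrite rmorphM /= conjCK mulrC.
move: sC; rewrite sE rmorphM /= rC rmorphN /= conjCi opprK => /eqP.
rewrite mulNr -addr_eq0 -mulr2n mulrn_eq0 mulf_eq0 (negbTE r0) orbF /=.
by rewrite (negbTE (neq0Ci _)).
Qed.

Definition cayley (A : 'M[C]_n) : 'M[C]_n := invmx (A + 'i%:M) *m (A - 'i%:M).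

Lemma trmxC_shift A :
  hermitian A -> ((A + 'i%:M)^T ^ Num.conj = A - 'i%:M)%sesqui.
Proof.
move=> hA; apply/matrixP => i j.
rewrite !mxE rmorphD rmorphMn /= conjCi -(hA j i).
by rewrite eq_sym mulNrn.
Qed.

(** The factors [P = A + i] and [Q = A - i] are adjoint to each other and commute, so [P^-1 Q] times
    its adjoint [P Q^-1] is 1. *)
Lemma cayley_unitary A : hermitian A -> cayley A \is unitarymx.
Proof.
move=> hA; apply/unitarymxP; set P := A + 'i%:M; set Q := A - 'i%:M.
have uP : P \in unitmx by rewrite unitmxE unitfE hermitian_shift_unit.
have PC : (P^T ^ Num.conj = Q)%sesqui by exact: trmxC_shift.
have QC : (Q^T ^ Num.conj = P)%sesqui.
  by apply/matrixP => i j; rewrite -PC !mxE conjCK.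
have uQ : Q \in unitmx by rewrite -PC map_unitmx unitmx_tr.
have PQ : P *m Q = Q *m P.
  rewrite mulmxDl !mulmxBr mulmxBl !mulmxDr scalar_mxC.
  by rewrite addrA subrK opprD addrA addrK.
rewrite /cayley trmx_mul map_mxM trmx_inv map_invmx -/P -/Q PC QC.
rewrite mulmxA -(mulmxA _ Q) -PQ mulmxA mulVmx// mul1mx mulmxV//.
Qed.

Section one_variable.
Context (d : nat) (Y : 'I_d -> 'M[C]_n) (j : 'I_d).
Context (p q : nat) (e : ncrat C d p q).

Lemma polymx_mxdom : polymx (fun V => (ncfrac id (upd Y j V) (fun=> 1) e).1).
Proof.
move=> T S SA A A_S; have [S_cst _ _] := SA.
apply: (ncfrac_closed SA id
  (Y := fun t => upd Y j (A t)) (h := fun=> fun=> 1) _ _ e).1.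
- by move=> k a b; rewrite /upd; case: eqP => _; [exact: A_S|exact: S_cst].
- by move=> k; exact: S_cst.
Qed.

(** The matrix put at [j] is [cayley A *m U], as a numerator over the denominator [\det (A + i)].
    Passing this denominator through [h] makes the result polynomial in the entries of [A] and
    [U]. *)
Definition cayley_frac (U A : 'M[C]_n) : C :=
  (ncfrac id (upd Y j (\adj (A + 'i%:M) *m (A - 'i%:M) *m U))
             (upd (fun=> 1) j (\det (A + 'i%:M))) e).1.

Lemma cayley_frac_closed (T : Type) (S : (T -> C) -> Prop)
    (SA : function_algebra S) (A U : T -> 'M[C]_n)
    (A_S : forall a b, S (fun t => A t a b))
    (U_S : forall a b, S (fun t => U t a b)) :
  S (fun t => cayley_frac (U t) (A t)).
Proof.
have [S_cst S_add S_mul] := SA.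
have sh (s : C) a b : S (fun t => (A t + s%:M) a b).
  rewrite (_ : (fun t => _) = fun t => A t a b + s%:M a b); first exact: S_add.
  by apply/funext => t; rewrite !mxE.
apply: (ncfrac_closed SA id
  (Y := fun t => upd Y j (\adj (A t + 'i%:M) *m (A t - 'i%:M) *m U t))
  (h := fun t => upd (fun=> 1) j (\det (A t + 'i%:M))) _ _ e).1.
- move=> k a b; rewrite /upd; case: eqP => _; last exact: S_cst.
  apply: (closed_mulmx SA) => // a' b'.
  apply: (closed_mulmx SA) => a2 b2; first exact: (closed_adj SA).
  by rewrite (_ : (fun t => _) = fun t => (A t + (- 'i)%:M) a2 b2)// raddfN.
- move=> k; rewrite /upd; case: eqP => _; last exact: S_cst.
  exact: (closed_det SA).
Qed.

Lemma polymx_cayley_frac U : polymx (cayley_frac U).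
Proof.
move=> T S SA A A_S; apply: (cayley_frac_closed SA A_S) => a b.
by case: SA => S_cst _ _; exact: S_cst.
Qed.

Lemma cayley_fracP (U A : 'M[C]_n) : \det (A + 'i%:M) != 0 ->
  mxdom id (upd Y j (cayley A *m U)) e = (cayley_frac U A != 0).
Proof.
move=> dA.
have h0 k : upd (fun=> 1) j (\det (A + 'i%:M)) k != 0.
  by rewrite /upd; case: ifP; rewrite ?oner_neq0.
have [<- _] := ncfracP id (upd Y j (\adj (A + 'i%:M) *m (A - 'i%:M) *m U)) h0 e.
congr (mxdom _ _ e); apply/funext => k; rewrite /upd; case: eqP => _.
  by rewrite /cayley /invmx unitmxE unitfE dA -!scalemxAl.
by rewrite invr1 scale1r.
Qed.

(** The inverse Cayley transform [B = i (1 + V) (1 - V)^-1] satisfies [B + i = 2i (1 - V)^-1] and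
    [B - i = 2i V (1 - V)^-1]. *)
Lemma cayley_onto (V : 'M[C]_n) : 1%:M - V \in unitmx ->
  exists2 B, \det (B + 'i%:M) != 0 & cayley B = V.
Proof.
move=> u; pose T := invmx (1%:M - V); pose c : C := 'i *+ 2.
have c0 : c != 0 by rewrite mulrn_eq0 /= neq0Ci.
have TV : (1%:M - V) *m T = 1%:M by exact: mulmxV.
have uT : T \in unitmx by rewrite unitmx_inv.
have iE : 'i%:M = 'i *: ((1%:M - V) *m T) by rewrite TV scalemx1.
have EP : 'i *: ((1%:M + V) *m T) + 'i%:M = c *: T.
  rewrite iE -scalerDr -mulmxDl addrACA subrr addr0 mulmxDl mul1mx.
  by rewrite -mulr2n -scalerMnr scalerMnl.
have EQ : 'i *: ((1%:M + V) *m T) - 'i%:M = c *: (V *m T).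
  rewrite iE -scalerBr -mulmxBl opprB [1%:M + V]addrC addrACA subrr addr0.
  by rewrite mulmxDl -mulr2n -scalerMnr scalerMnl.
exists ('i *: ((1%:M + V) *m T)).
  by rewrite EP detZ mulf_neq0 ?expf_neq0// -unitfE -unitmxE.
rewrite /cayley EP EQ invmxZ ?unitmxZ ?unitfE// invmxK -scalemxAl -scalemxAr.
rewrite scalerA mulVf// scale1r mulmxA.
have -> : (1%:M - V) *m V = V *m (1%:M - V).
  by rewrite mulmxBl mulmxBr mul1mx mulmx1.
by rewrite -mulmxA TV mulmx1.
Qed.

(** To reach [cayley B *m U = k W] with [B] from [cayley_onto], the matrix [1 - k W U^-1] must be
    invertible and [k W] must stay in the domain. These are polynomial conditions on [k], satisfied
    at 0 and at 1 respectively, so some natural number [k] serves; [polymx_hermitian] then replaces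
    [B]. *)
Lemma mxdom_cayley (U W : 'M[C]_n) : U \in unitmx ->
  mxdom id (upd Y j W) e ->
  exists2 A, hermitian A & mxdom id (upd Y j (cayley A *m U)) e.
Proof.
move=> uU; rewrite mxdomE => dW.
have p1 := polymx_mxdom (polyfun_algebra id) (polyfun_line 0 W).
have p2 : polyfun id (fun t => \det (1%:M + t *: (- (W *m invmx U)))).
  exact: (closed_det (polyfun_algebra id) (polyfun_line _ _)).
have [||k [k1 k2]] := polyfun_nonroot2 (u := id) (@natr_inj_num C)
  (a := 1) (b := 0) p1 p2.
- by rewrite /= add0r scale1r.
- by rewrite scale0r addr0 det1 oner_neq0.
have [|B dB BV] := @cayley_onto (k%:R *: (W *m invmx U)).
  by rewrite unitmxE unitfE -scalerN.
have [|A hA FA] := polymx_hermitian (polymx_cayley_frac U) (W := B).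
  rewrite -cayley_fracP// BV -scalemxAl mulmxKV// mxdomE.
  by move: k1; rewrite /= add0r.
by exists A => //; rewrite cayley_fracP// hermitian_shift_unit.
Qed.

Lemma mxdom_hermitian (W : 'M[C]_n) : mxdom id (upd Y j W) e ->
  exists2 A, hermitian A & mxdom id (upd Y j A) e.
Proof.
rewrite mxdomE => /(polymx_hermitian polymx_mxdom)[A hA FA].
by exists A; rewrite ?mxdomE.
Qed.

End one_variable.

End matrix_polynomials.

Lemma mxdom_replace (K : fieldType) d n p q (e : ncrat K d p q)
    (good : 'I_d -> 'M[K]_n -> Prop)
    (replace : forall j Y W, mxdom id (upd Y j W) e ->
      exists2 A, good j A & mxdom id (upd Y j A) e) (Y : 'I_d -> 'M[K]_n) :
  mxdom id Y e -> exists2 Y', forall j, good j (Y' j) & mxdom id Y' e.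
Proof.
move=> dY.
have [Y' gY' dY'] :
    exists2 Y', {in enum 'I_d, forall j, good j (Y' j)} & mxdom id Y' e.
  elim: (enum 'I_d) => [|j s [Y' gY' dY']]; first by exists Y.
  have [|A gA dA] := replace j Y' (Y' j).
    rewrite (_ : upd _ _ _ = Y')//.
    by apply/funext => k; rewrite /upd; case: eqP => [->|].
  exists (upd Y' j A) => // k; rewrite inE /upd; case: eqP => [->//|_ /=].
  exact: gY'.
by exists Y' => // j; apply: gY'; rewrite mem_enum.
Qed.

(** * Null sets *)

Section product_null_sets.
Local Open Scope ereal_scope.
Context d1 d2 (T1 : measurableType d1) (T2 : measurableType d2) (R : realType).
Context (m1 : {sigma_finite_measure set T1 -> \bar R}).
Context (m2 : {sigma_finite_measure set T2 -> \bar R}).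

Lemma sfprod_xsection_null (E : set (T1 * T2)) (N : set T1) :
  measurable E -> measurable N -> m1 N = 0 ->
  (forall x, ~ N x -> m2 (xsection E x) = 0) -> sfprod m1 m2 E = 0.
Proof.
move=> mE mN N0 HN; rewrite /sfprod /product_measure1.
rewrite (ae_eq_integral (cst 0))//= ?integral0//.
  exact: measurable_fun_xsection.
by exists N; split=> // x /= /not_implyP[_ Ex]; apply: contrapT => /HN.
Qed.

Lemma sfprod_ysection (E : set (T1 * T2)) : measurable E ->
  sfprod m1 m2 E = \int[m2]_y m1 (ysection E y).
Proof.
move=> mE; apply: (product_measure_unique (m' := m1 \x^ m2)) => // A B mA mB.
exact: product_measure2E.
Qed.

Lemma sfprod_ysection_null (E : set (T1 * T2)) (N : set T2) :
  measurable E -> measurable N -> m2 N = 0 ->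
  (forall y, ~ N y -> m1 (ysection E y) = 0) -> sfprod m1 m2 E = 0.
Proof.
move=> mE mN N0 HN; rewrite sfprod_ysection//.
rewrite (ae_eq_integral (cst 0))//= ?integral0//.
  exact: measurable_fun_ysection.
by exists N; split=> // x /= /not_implyP[_ Ex]; apply: contrapT => /HN.
Qed.

Lemma sfprod_setT : sfprod m1 m2 setT = m1 setT * m2 setT.
Proof. by rewrite -setXTT [LHS]product_measure1E. Qed.

End product_null_sets.

Section power_null_sets.
Local Open Scope ereal_scope.
Context d (T : measurableType d) (R : realType).
Context (mu : {sigma_finite_measure set T -> \bar R}).

Lemma power_measure_setT n : mu setT != 0 -> power_measure mu n setT != 0.
Proof.
move=> mu0; elim: n => [|n IH] /=.
  by rewrite diracT oner_neq0.
by rewrite /push /pushforward preimage_setT sfprod_setT mule_neq0.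
Qed.

Definition upd_tuple n (t : n.-tuple T) (i : 'I_n) (s : T) : n.-tuple T :=
  [tuple if k == i then s else tnth t k | k < n].

(** Fubini's theorem and induction. Fix the head of a point [t0] outside [E]: the tails that
    complete it to a point of [E] form a null set by induction. Over any other tail the line in the
    first coordinate leaves [E], so it meets [E] in a null set. *)
Lemma power_measure_null n (E : set (n.-tuple T)) :
  measurable E ->
  (forall t i s, ~ E (upd_tuple t i s) ->
    mu [set s' | E (upd_tuple t i s')] = 0) ->
  (exists t, ~ E t) -> power_measure mu n E = 0.
Proof.
elim: n => [|n IH] in E *.
  move=> mE _ [t Et] /=; rewrite diracE [_ \in _](_ : _ = false)//.
  by apply/negbTE/negP; rewrite inE => E0; apply: Et; rewrite tuple0.
move=> mE slice [t0 Et0] /=.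
have cons0 s (t' : n.-tuple T) :
    tcons (s, t') = upd_tuple (tcons (thead t0, t')) ord0 s.
  apply: eq_from_tnth => k; rewrite tnth_mktuple.
  by case: (unliftP ord0 k) => [k' ->|->]; rewrite /tcons ?tnthS ?tnth0 ?eqxx.
have consS s (t' : n.-tuple T) i r :
    tcons (s, upd_tuple t' i r) = upd_tuple (tcons (s, t')) (lift ord0 i) r.
  apply: eq_from_tnth => k; rewrite tnth_mktuple.
  case: (unliftP ord0 k) => [k' ->|->]; rewrite /tcons ?tnthS ?tnth0//.
  by rewrite tnth_mktuple (inj_eq lift_inj).
have mtc := @measurable_tcons _ T n.
have mE' : measurable (@tcons _ T n @^-1` E).
  by rewrite -[X in measurable X]setTI; exact: mtc.
have Exs : xsection (@tcons _ T n @^-1` E) (thead t0) =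
    [set t' | E (tcons (thead t0, t'))].
  by apply/seteqP; split=> t' /=; rewrite /xsection/= inE.
have mN : measurable [set t' | E (tcons (thead t0, t'))].
  by rewrite -Exs; exact: measurable_xsection.
rewrite /push /pushforward; apply: (sfprod_ysection_null mE' mN).
  apply: IH => //.
    move=> t' i s; rewrite /= consS => /slice H.
    by under eq_set do rewrite consS.
  exists [tuple of behead t0] => /=; rewrite /tcons/= => H; apply: Et0.
  by rewrite (tuple_eta t0).
move=> t' /= nE.
have -> : ysection (@tcons _ T n @^-1` E) t' =
    [set s | E (upd_tuple (tcons (thead t0, t')) ord0 s)].
  by apply/seteqP; split=> s /=; rewrite /ysection/= inE /= (cons0 s).
by apply: (slice _ _ (thead t0)); rewrite -cons0.
Qed.

End power_null_sets.

(** * Measurability and null zero sets of polynomials in matrices *)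

Section complex_measurability.
Context d (T : measurableType d) (R : realType).

Definition cmeasurable (f : T -> R[i]) :=
  measurable_fun setT (fun t => complex.Re (f t)) /\
  measurable_fun setT (fun t => complex.Im (f t)).

Lemma cmeasurable_algebra : function_algebra cmeasurable.
Proof.
split=> [a|f g [rf jf] [rg jg]|f g [rf jf] [rg jg]].
- by split; exact: measurable_cst.
- split.
    rewrite (_ : (fun t => _) = (fun t => complex.Re (f t) + complex.Re (g t))).
      exact: measurable_funD.
    by apply/funext => t; case: (f t) (g t) => ? ? [].
  rewrite (_ : (fun t => _) = (fun t => complex.Im (f t) + complex.Im (g t))).
    exact: measurable_funD.
  by apply/funext => t; case: (f t) (g t) => ? ? [].
- split.
    rewrite (_ : (fun t => _) = (fun t => complex.Re (f t) * complex.Re (g t) -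
                                          complex.Im (f t) * complex.Im (g t))).
      by apply: measurable_funB; exact: measurable_funM.
    by apply/funext => t; case: (f t) (g t) => ? ? [].
  rewrite (_ : (fun t => _) = (fun t => complex.Re (f t) * complex.Im (g t) +
                                        complex.Im (f t) * complex.Re (g t))).
    by apply: measurable_funD; exact: measurable_funM.
  by apply/funext => t; case: (f t) (g t) => ? ? [].
Qed.

Lemma cmeasurable_zeros f : cmeasurable f -> measurable [set t | f t = 0].
Proof.
move=> [rf jf]; rewrite (_ : [set t | _] =
    (fun t => complex.Re (f t)) @^-1` [set 0] `&`
    (fun t => complex.Im (f t)) @^-1` [set 0]).
  apply: measurableI; rewrite -[X in measurable X]setTI.
    exact: rf.
  exact: jf.
apply/seteqP; split=> t /=; first by move=> ->.
by case: (f t) => a b /= [-> ->].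
Qed.

End complex_measurability.

Lemma cmeasurable_comp d d' (T : measurableType d) (T' : measurableType d')
    (R : realType) (g : T -> T') (f : T' -> R[i]) :
  measurable_fun setT g -> cmeasurable f -> cmeasurable (f \o g).
Proof.
move=> mg [rf jf]; split.
  exact: (measurableT_comp rf mg).
exact: (measurableT_comp jf mg).
Qed.

Section null_sets_of_matrices.
Context (R : realType).
Local Notation C := R[i].
Local Notation toC := (fun s : R => s%:C%C).

Lemma lebesgue_polyfun_null (f : R -> C) s0 :
  polyfun toC f -> f s0 != 0 -> lebesgue_measure [set s | f s = 0] = 0%E.
Proof.
move=> pf f0; apply/countable_lebesgue_measure0/finite_set_countable.
have [r rE] := pf; have r0 : r != 0.
  by apply: contraNneq f0 => r0; rewrite rE r0 horner0.
(* The nonzero polynomial [r] has fewer than [size r] roots, so its real zeros form a finite set. *)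
apply: contrapT => /(infinite_set_fset (size r))[B BA szB].
suff : (size (map toC (finmap.enum_fset B)) < size r)%N.
  by rewrite size_map ltnNge szB.
apply: max_poly_roots => //.
  apply/allP => x /mapP[s sB ->]; rewrite /root -rE.
  by apply/eqP; exact: BA.
by rewrite map_inj_uniq ?finmap.fset_uniq//; exact: complexI.
Qed.

Context (n : nat).

Lemma selfadj_hermitian (A : selfadj R n) : hermitian (selfadj_mx A).
Proof. by move=> i j; exact: selfadjE. Qed.

Lemma hermitianP (A : 'M[C]_n) : hermitian A -> A \is hermsymmx.
Proof.
move=> hA; apply/is_hermitianmxP; rewrite scale1r; apply/matrixP => i j.
by rewrite !mxE -hA.
Qed.

Lemma polyfun_selfadj_of_real (t : (n * n).-tuple R) i a b :
  polyfun toC (fun s => selfadj_mx (selfadj_of_real (upd_tuple t i s)) a b).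
Proof.
have pt k : polyfun toC (fun s => (tnth (upd_tuple t i s) k)%:C%C).
  have [ki|ki] := eqVneq k i.
    by exists 'X => s; rewrite hornerX tnth_mktuple ki eqxx.
  by exists (tnth t k)%:C%C%:P => s; rewrite hornerC tnth_mktuple (negbTE ki).
have pD k l (c : C) : polyfun toC (fun s => (tnth (upd_tuple t i s) k)%:C%C +
    c * (tnth (upd_tuple t i s) l)%:C%C).
  apply: polyfunD; first exact: pt.
  by apply: polyfunM; [exact: polyfun_cst|exact: pt].
have -> : (fun s => selfadj_mx (selfadj_of_real (upd_tuple t i s)) a b) =
    fun s => selfadj_entry (upd_tuple t i s) a b.
  by apply/funext => s; rewrite /= mxE.
rewrite /selfadj_entry; case: eqP => [_|_]; first exact: pt.
case: (a < b)%N.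
  have [r rE] := pD (mxvec_index a b) (mxvec_index b a) ('i)%C; exists r => s.
  rewrite -rE; apply/eqP; rewrite eq_complex /=.
  by rewrite !(mul0r, mul1r, mulr0, subr0, addr0, add0r) !eqxx.
have [r rE] := pD (mxvec_index b a) (mxvec_index a b) (- 'i)%C; exists r => s.
rewrite -rE; apply/eqP; rewrite eq_complex /=.
by rewrite !(oppr0, mulN1r, mul0r, mulr0, subr0, addr0, add0r) !eqxx.
Qed.

Lemma cmeasurable_selfadj a b :
  cmeasurable (fun A : selfadj R n => selfadj_mx A a b).
Proof. exact: measurable_selfadj_entry. Qed.

Lemma cmeasurable_unitary a b :
  cmeasurable (fun U : unitary R n => unitary_mx U a b).
Proof.
pose t (A : unitary R n) := tnth (unitary_coord A) (mxvec_index a b).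
have mt : measurable_fun setT t.
  apply: (measurableT_comp (measurable_tnth (mxvec_index a b))).
  by move=> _ Y mY; exists Y.
split.
- rewrite (_ : (fun _ => _) = fst \o t); first exact: measurableT_comp.
  by apply/funext => A; rewrite /t /= tnth_mktuple mxvecE.
- rewrite (_ : (fun _ => _) = snd \o t); first exact: measurableT_comp.
  by apply/funext => A; rewrite /t /= tnth_mktuple mxvecE.
Qed.

(** In the real coordinates of [selfadj_of_real], [F] is a polynomial along each coordinate line, so
    its zero set contains the line or meets it in a null set; [polymx_hermitian] supplies a point
    off the zero set. *)
Lemma lebesgue_selfadj_null (F : 'M[C]_n -> C) W :
  polymx F -> F W != 0 ->
  lebesgue_selfadj R n [set A | F (selfadj_mx A) = 0] = 0%E.
Proof.
move=> pF FW.
have mF : measurable [set A : selfadj R n | F (selfadj_mx A) = 0].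
  apply: cmeasurable_zeros.
  exact: (pF _ _ (cmeasurable_algebra _ _) _ cmeasurable_selfadj).
rewrite /lebesgue_selfadj /= /push /pushforward; apply: power_measure_null.
- by rewrite -[X in measurable X]setTI; exact: measurable_selfadj_of_real.
- move=> t i s /= /eqP Fs; apply: (@lebesgue_polyfun_null _ s) => //.
  exact: (pF _ _ (polyfun_algebra _) _ (polyfun_selfadj_of_real t i)).
- have [A hA FA] := polymx_hermitian pF FW.
  exists (real_of_selfadj (Selfadj (hermitianP hA))).
  by rewrite /preimage /mkset real_of_selfadjK /=; apply/eqP.
Qed.

Lemma lebesgue_selfadj_setT : lebesgue_selfadj R n setT != 0%E.
Proof.
rewrite /lebesgue_selfadj /= /push /pushforward preimage_setT.
apply: power_measure_setT; suff : lebesgue_measure [set: R] != 0%E by [].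
by rewrite -set_itvNyy lebesgue_measure_itv.
Qed.

Section haar.
Local Open Scope ereal_scope.
Context (haar : probability (unitary R n) R) (haarP : is_haar haar).
Context (d p q : nat) (e : ncrat C d p q) (Y : 'I_d -> 'M[C]_n) (j : 'I_d).

Definition selfadj_cayley (A : selfadj R n) : unitary R n :=
  Unitary (cayley_unitary (selfadj_hermitian A)).

Lemma haar_null W : mxdom id (upd Y j W) e ->
  haar [set U | ~~ mxdom id (upd Y j (unitary_mx U)) e] = 0.
Proof.
move=> dW; set Z := [set U : unitary R n | _].
have mZ : measurable Z.
  rewrite (_ : Z =
      [set U | (ncfrac id (upd Y j (unitary_mx U)) (fun=> 1%R) e).1 = 0%R]).
    apply: cmeasurable_zeros.
    exact: (@polymx_mxdom _ _ _ Y j _ _ e _ _ (cmeasurable_algebra _ _) _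
      cmeasurable_unitary).
  apply/seteqP; split=> U /=; rewrite /Z /= mxdomE negbK => /eqP//.
pose E := [set AU : selfadj R n * unitary R n |
  cayley_frac Y j e (unitary_mx AU.2) (selfadj_mx AU.1) = 0%R].
have EE AU : E AU <->
  ~~ mxdom id (upd Y j (cayley (selfadj_mx AU.1) *m unitary_mx AU.2)) e.
  rewrite cayley_fracP ?negbK; last first.
    exact/hermitian_shift_unit/selfadj_hermitian.
  by split=> /eqP.
have mE : measurable E.
  apply: cmeasurable_zeros.
  apply: (cayley_frac_closed _ _ _ (cmeasurable_algebra _ _)) => a b.
    exact: (cmeasurable_comp measurable_fst (cmeasurable_selfadj a b)).
  exact: (cmeasurable_comp measurable_snd (cmeasurable_unitary a b)).
(* For fixed [U] the slice of [E] is the zero set of a polynomial in [A], which is nonzero somewhere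
   by [mxdom_cayley]. *)
have E0 : sfprod (lebesgue_selfadj R n) haar E = 0.
  apply: (sfprod_ysection_null mE measurable0); rewrite ?measure0// => U _.
  have uU : unitary_mx U \in unitmx by exact/unitarymx_unit/unitary_mxP.
  have [A hA] := mxdom_cayley uU dW.
  rewrite cayley_fracP ?hermitian_shift_unit// => FA.
  rewrite -[RHS](lebesgue_selfadj_null
    (polymx_cayley_frac Y j e (unitary_mx U)) FA).
  congr (lebesgue_selfadj _ _ _); apply/seteqP.
  by split=> B; rewrite /ysection /= inE.
(* For fixed [A] the slice of [E] is the preimage of [Z] under left translation by [cayley A], of
   mass [haar Z] by invariance. The nonzero total Lebesgue mass then forces [haar Z = 0]. *)
have : haar Z * lebesgue_selfadj R n setT = 0.
  rewrite -[RHS]E0 /sfprod /product_measure1 -integral_cst//.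
  apply: eq_integral => A _ /=; rewrite -(haarP (selfadj_cayley A) mZ).
  congr (haar _); apply/seteqP; split=> U; rewrite /xsection /= inE.
    by move=> H; apply/EE.
  by move/EE.
by move/eqP; rewrite mule_eq0 (negbTE lebesgue_selfadj_setT) orbF => /eqP.
Qed.

End haar.
End null_sets_of_matrices.

(** * Tuples of self-adjoint and unitary matrices *)

Section random_matrices.
Context (R : realType) (d1 d2 n p q : nat) (e : ncrat R[i] (d1 + d2) p q).
Local Notation C := R[i].

Lemma matspace_point (X : 'I_(d1 + d2) -> 'M[C]_n) : mxdom id X e ->
  exists XU : matspace R d1 d2 n, mxdom id (matrices_of XU) e.
Proof.
pose good (j : 'I_(d1 + d2)) (A : 'M[C]_n) : Prop :=
  match fintype.split j with
  | inl _ => A \is hermsymmx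
  | inr _ => A \is unitarymx
  end.
move=> dX; have [|Y gY dY] := mxdom_replace (good := good) _ dX.
  move=> j Y W dW; rewrite /good; case: (fintype.split j) => _.
    by have [A hA dA] := mxdom_hermitian dW; exists A => //; exact: hermitianP.
  (* With [U = 1] the new matrix is a Cayley transform, hence unitary. *)
  have [A hA dA] := mxdom_cayley (unitmx1 _ _) dW; rewrite mulmx1 in dA.
  by exists (cayley A) => //; exact: cayley_unitary.
have /choice[f fE] k : exists A : selfadj R n, selfadj_mx A = Y (lshift d2 k).
  have := gY (lshift d2 k); rewrite /good.
  rewrite (_ : fintype.split _ = inl k); last exact: (unsplitK (inl k)).
  by move=> H; exists (Selfadj H).
have /choice[g gE] k : exists U : unitary R n, unitary_mx U = Y (rshift d1 k).
  have := gY (rshift d1 k); rewrite /good.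
  rewrite (_ : fintype.split _ = inr k); last exact: (unsplitK (inr k)).
  by move=> H; exists (Unitary H).
exists ([tuple f k | k < d1], [tuple g k | k < d2]).
rewrite (_ : matrices_of _ = Y)//; apply/funext => j.
rewrite /matrices_of -{2}(splitK j); case: (fintype.split j) => k /=.
  by rewrite tnth_mktuple fE.
by rewrite tnth_mktuple gE.
Qed.

Lemma matrices_of_upd1 (t : d1.-tuple (selfadj R n)) U i s :
  matrices_of (upd_tuple t i s, U) =
  upd (matrices_of (t, U)) (lshift d2 i) (selfadj_mx s).
Proof.
apply/funext => j; rewrite /matrices_of /upd -{2}(splitK j).
case: (fintype.split j) => k /=; last by rewrite eq_rlshift.
by rewrite tnth_mktuple (inj_eq (@lshift_inj _ _)); case: eqP.
Qed.

Lemma matrices_of_upd2 X (t : d2.-tuple (unitary R n)) i s :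
  matrices_of (X, upd_tuple t i s) =
  upd (matrices_of (X, t)) (rshift d1 i) (unitary_mx s).
Proof.
apply/funext => j; rewrite /matrices_of /upd -{2}(splitK j).
case: (fintype.split j) => k /=; first by rewrite eq_lrshift.
by rewrite tnth_mktuple (inj_eq (@rshift_inj _ _)); case: eqP.
Qed.

Definition outside_dom :=
  [set XU : matspace R d1 d2 n | ~~ mxdom id (matrices_of XU) e].

Lemma measurable_outside_dom : measurable outside_dom.
Proof.
rewrite (_ : outside_dom =
    [set XU | (ncfrac id (matrices_of XU) (fun=> 1) e).1 = 0]).
  apply: cmeasurable_zeros.
  apply: (ncfrac_closed (cmeasurable_algebra _ _) id
    (Y := @matrices_of R d1 d2 n) (h := fun=> fun=> 1) _ _ e).1 => j.
    move=> a b; rewrite /matrices_of; case: (fintype.split j) => k.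
      have mk :
          measurable_fun setT (fun XU : matspace R d1 d2 n => tnth XU.1 k).
        exact: (measurableT_comp (measurable_tnth k) measurable_fst).
      exact: (cmeasurable_comp mk (cmeasurable_selfadj R a b)).
    have mk : measurable_fun setT (fun XU : matspace R d1 d2 n => tnth XU.2 k).
      exact: (measurableT_comp (measurable_tnth k) measurable_snd).
    exact: (cmeasurable_comp mk (cmeasurable_unitary R a b)).
  by have [+ _ _] := @cmeasurable_algebra _ (matspace R d1 d2 n) R; apply.
by apply/seteqP; split=> XU /=; rewrite /outside_dom /= mxdomE negbK => /eqP.
Qed.

(** From one point [(X0, U0)] of the domain, almost every [X] keeps [(X, U0)] in the domain; for
    each such [X], almost every [U] keeps [(X, U)] there. Each half applies [power_measure_null],
    one matrix at a time. *)
Lemma reference_outside_dom (haar : probability (unitary R n) R)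
    (haarP : is_haar haar) (X : 'I_(d1 + d2) -> 'M[C]_n) :
  mxdom id X e -> reference_measure d1 d2 haar outside_dom = 0%E.
Proof.
move=> /matspace_point[[X0 U0] d0].
have m1 : measurable [set X | outside_dom (X, U0)].
  rewrite (_ : [set _ | _] = ysection outside_dom U0).
    by apply: measurable_ysection; exact: measurable_outside_dom.
  by apply/seteqP; split=> Y; rewrite /ysection /= inE.
apply: (sfprod_xsection_null measurable_outside_dom m1).
  apply: power_measure_null => //; last by exists X0; apply/negP; rewrite negbK.
  move=> t i s /negP; rewrite negbK matrices_of_upd1 mxdomE => dt.
  rewrite -[RHS](lebesgue_selfadj_null (polymx_mxdom _ _ e) dt).
  congr (lebesgue_selfadj _ _ _); apply/seteqP; split=> A /=.
    by rewrite /outside_dom /= matrices_of_upd1 mxdomE negbK => /eqP.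
  by rewrite /outside_dom /= matrices_of_upd1 mxdomE negbK => /eqP.
move=> Y /negP; rewrite negbK => dY.
have -> : xsection outside_dom Y = [set U | outside_dom (Y, U)].
  by apply/seteqP; split=> U; rewrite /xsection /= inE.
apply: power_measure_null.
- rewrite (_ : [set _ | _] = xsection outside_dom Y).
    by apply: measurable_xsection; exact: measurable_outside_dom.
  by apply/seteqP; split=> U; rewrite /xsection /= inE.
- move=> t i s /negP; rewrite negbK matrices_of_upd2 => dt.
  rewrite -[RHS](haar_null haarP dt); congr (haar _).
  by apply/seteqP; split=> U /=; rewrite /outside_dom /= matrices_of_upd2.
- by exists U0; apply/negP; rewrite negbK.
Qed.

End random_matrices.

Theorem theorem18 (R : realType) (d1 d2 p q : nat)
  (e : ncrat R[i] (d1 + d2) p q) (e_nondegenerate : nc_nondegenerate e)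
  (haar : forall N : nat, probability (unitary R N.+1) R)
  (haarP : forall N : nat, is_haar (haar N))
  (mu : forall N : nat, probability (matspace R d1 d2 N.+1) R)
  (mu_ac : forall N : nat, mu N `<< reference_measure d1 d2 (haar N))
  (dO : measure_display) (Omega : measurableType dO) (P : probability Omega R)
  (XU : forall N : nat, {RV P >-> matspace R d1 d2 N.+1})
  (XU_law : forall (N : nat) (B : set (matspace R d1 d2 N.+1)),
     measurable B -> distribution P (XU N) B = mu N B) :
  exists N0 : nat,
    {ae P, forall w : Omega, forall N : nat, (N0 <= N.+1)%N ->
       ncdom (matrices_of (XU N w)) e}.
Proof.
have [m [X0 /(ncdomP X0 e).1 dX0]] := e_nondegenerate.
have [N0 domN] := mxdom_all_sizes dX0.
exists N0; pose bad N := XU N @^-1` outside_dom e.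
(* The exceptional event is a countable union over the sizes. Each member is null, since the law at
   that size is absolutely continuous and the complement of the domain is null for the reference
   measure. *)
have : P.-negligible (\bigcup_(N in [set N | (N0 <= N.+1)%N]) bad N).
  rewrite bigcup_mkcond; apply: negligible_bigcup => N; case: ifPn => [|_].
    rewrite inE /= => /domN[X dX].
    have mb : measurable (bad N).
      rewrite /bad -[X in measurable X]setTI.
      by apply: measurable_funPT => //; exact: measurable_outside_dom.
    apply/negligibleP => //.
    have /null_content_dominatesP := mu_ac N.
    move=> /(_ _ (measurable_outside_dom e)).
    rewrite -XU_law; last exact: measurable_outside_dom.
    by apply; exact: reference_outside_dom (haarP N) _ dX.
  exact: negligible_set0.
move=> [B [mB PB subB]]; exists B; split=> // w /=.
move=> /existsNP[N /not_implyP[N0N dN]].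
apply: subB; exists N => //; rewrite /bad /outside_dom /=.
by apply/negP => d; apply: dN; exact/(ncdomP _ e).1.
Qed.
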